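(* Let $0<\sigma<\infty$. Every weak$^*$ exposed point of $D(B^1_\sigma)$ is weak$^*$ strongly exposed; that is, the set of weak$^*$ exposed points of $D(B^1_\sigma)$ equals the set of weak$^*$ strongly exposed points of $D(B^1_\sigma)$.
   Context: For $0<\sigma<\infty$, $B^1_\sigma$ is the space of $f\in L^1(\mathbb{R})$ whose Fourier transform is supported in $[-\sigma,\sigma]$, with the $L^1(\mathbb{R})$ norm; $D(B^1_\sigma)$ is its closed unit ball. $C_0(\mathbb{R})$ is the space of continuous complex functions vanishing at infinity; with $\mathfrak{I}_\sigma$ the finite complex Borel measures on $\mathbb{R}$ whose Fourier–Stieltjes transform vanishes for $|t|\ge\sigma$ and $C_{0,\sigma}(\mathbb{R})=\{u\in C_0(\mathbb{R}):\int u\,d\mu=0\ \forall\mu\in\mathfrak{I}_\sigma\}$, $B^1_\sigma$ is the dual of $C_0(\mathbb{R})/C_{0,\sigma}(\mathbb{R})$ via $\langle f,[u]\rangle=\int f u\,dx$; weak$^*$ refers to this duality. A point $f\in D(B^1_\sigma)$ is exposed if there is a continuous linear functional $\Phi_f$ on $B^1_\sigma$ with $\Phi_f(f)=\|\Phi_f\|=1$ and $\mathrm{Re}\,\Phi_f(g)<1$ for all $g\in D(B^1_\sigma)$, $g\ne f$ (this functional is unique). An exposed $f$ is strongly exposed if every sequence $(f_n)$ in $D(B^1_\sigma)$ with $\Phi_f(f_n)\to1$ converges to $f$ in norm; it is weak$^*$ exposed if $\Phi_f$ is weak$^*$ continuous; it is weak$^*$ strongly exposed if it is both weak$^*$ exposed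 and strongly exposed. *)

(* Defs.v *)
From HB Require Import structures.
From mathcomp Require Import all_boot all_order all_algebra.
From mathcomp Require Import all_classical all_reals all_analysis.
From mathcomp Require Import complex.

Set Implicit Arguments.
Unset Strict Implicit.
Unset Printing Implicit Defensive.

Import Order.TTheory GRing.Theory Num.Theory.
Import numFieldNormedType.Exports.
Local Open Scope classical_set_scope.
Local Open Scope ring_scope.

Section BernsteinSpace.
Variable R : realType.

Local Notation F := (R -> R[i]).
Local Notation leb := (@lebesgue_measure R).

Definition cRe (z : R[i]) : R := complex.Re z.
Definition cIm (z : R[i]) : R := complex.Im z.

Definition cnorm (z : R[i]) : R := Num.sqrt (cRe z ^+ 2 + cIm z ^+ 2).

Definition cintegrable (f : F) : Prop :=
  leb.-integrable setT (fun x => (cRe (f x))%:E) /\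
  leb.-integrable setT (fun x => (cIm (f x))%:E).

Definition cint (f : F) : R[i] :=
  Complex (Rintegral leb setT (fun x => cRe (f x)))
          (Rintegral leb setT (fun x => cIm (f x))).

Definition L1norm (f : F) : R := Rintegral leb setT (fun x => cnorm (f x)).

Definition L1eq (f g : F) : Prop := {ae leb, forall x, f x = g x}.

Definition expi (t : R) : R[i] := Complex (cos t) (sin t).

Definition fourier (f : F) (t : R) : R[i] :=
  cint (fun x => f x * expi (- (x * t))).

Definition inB (sigma : R) (f : F) : Prop :=
  cintegrable f /\ forall t, sigma < `|t| -> fourier f t = 0.

Definition inD (sigma : R) (f : F) : Prop := inB sigma f /\ L1norm f <= 1.

Definition linear_on_B (sigma : R) (Phi : F -> R[i]) : Prop :=
  forall (a : R[i]) (f g : F), inB sigma f -> inB sigma g ->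
    Phi (fun x => a * f x + g x) = a * Phi f + Phi g.

Definition norm_continuous_on_B (sigma : R) (Phi : F -> R[i]) : Prop :=
  forall g, inB sigma g -> forall e : R, 0 < e ->
    exists d : R, 0 < d /\
      forall h, inB sigma h -> L1norm (fun x => h x - g x) < d ->
        cnorm (Phi h - Phi g) < e.

Definition cont_lin_functional (sigma : R) (Phi : F -> R[i]) : Prop :=
  linear_on_B sigma Phi /\ norm_continuous_on_B sigma Phi.

Definition opnorm (sigma : R) (Phi : F -> R[i]) : R :=
  sup [set r | exists2 g, inD sigma g & r = cnorm (Phi g)].

Definition exposing (sigma : R) (f : F) (Phi : F -> R[i]) : Prop :=
  cont_lin_functional sigma Phi /\ Phi f = 1 /\ opnorm sigma Phi = 1 /\
  forall g, inD sigma g -> ~ L1eq g f -> cRe (Phi g) < 1.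

Definition exposed (sigma : R) (f : F) : Prop :=
  inD sigma f /\ exists Phi, exposing sigma f Phi.

Definition strongly_exposed (sigma : R) (f : F) : Prop :=
  exposed sigma f /\
  forall Phi, exposing sigma f Phi ->
    forall fn : nat -> F, (forall n, inD sigma (fn n)) ->
      (fun n => cnorm (Phi (fn n) - 1) : R) @ \oo --> 0 ->
      (fun n => L1norm (fun x => fn n x - f x) : R) @ \oo --> 0.

Definition C0 (u : F) : Prop :=
  continuous (fun x => cRe (u x)) /\ continuous (fun x => cIm (u x)) /\
  forall e : R, 0 < e -> exists M : R, forall x, M < `|x| -> cnorm (u x) < e.

Definition pairing (f u : F) : R[i] := cint (fun x => f x * u x).

(* Phi is continuous on B^1_sigma for the weak* topology
   sigma(B^1_sigma, C_0(R)/C_{0,sigma}(R)), written with its basic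
   neighbourhoods {h : |<h - g, [u_i]>| < d, i < n}. *)
Definition weakstar_continuous (sigma : R) (Phi : F -> R[i]) : Prop :=
  forall g, inB sigma g -> forall e : R, 0 < e ->
    exists (n : nat) (us : 'I_n -> F) (d : R),
      0 < d /\ (forall i, C0 (us i)) /\
      forall h, inB sigma h ->
        (forall i, cnorm (pairing (fun x => h x - g x) (us i)) < d) ->
        cnorm (Phi h - Phi g) < e.

Definition wstar_exposed (sigma : R) (f : F) : Prop :=
  inD sigma f /\
  exists Phi, exposing sigma f Phi /\ weakstar_continuous sigma Phi.

Definition wstar_strongly_exposed (sigma : R) (f : F) : Prop :=
  wstar_exposed sigma f /\ strongly_exposed sigma f.

End BernsteinSpace.

(* Main.v *)
(** Write a function of the Bernstein space as f = p + i q; since the band is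
symmetric, p and q are band-limited themselves. For a real band-limited h, Abel
summation of the Fourier integral turns e^{-e|t|} into the Poisson kernel, whose
primitive is an arctangent; letting e tend to 0 gives
h(y) = 1/pi int_0^sigma (C(t) cos(yt) + S(t) sin(yt)) dt for almost every y,
with C, S the cosine and sine transforms of h. Hence D(B^1_sigma) is uniformly
bounded and equi-Lipschitz, and a function with this representation that has
infinitely many zeros in a bounded interval vanishes identically.

Let f be exposed by the weak* continuous functional Phi. As f <> 0 a.e., the
norm is Gateaux differentiable at f, so Phi is the only functional exposing f.
If f_n in D and Phi(f_n) -> 1, a subsequence converges pointwise to some g in D;
weak* continuity gives Phi(g) = 1, so g = f, and ||f_n|| <= 1 = ||f|| upgrades
pointwise convergence to norm convergence (Scheffe). *)

Require Import Defs.
From HB Require Import structures.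
From mathcomp Require Import all_boot all_order all_algebra.
From mathcomp Require Import all_classical all_reals all_analysis.
From mathcomp Require Import complex.
From mathcomp Require Import measurable_realfun ring lra.
Import Order.TTheory GRing.Theory Num.Theory.
Import numFieldNormedType.Exports.
Set Implicit Arguments.
Unset Strict Implicit.
Unset Printing Implicit Defensive.
Local Open Scope classical_set_scope.
Local Open Scope ring_scope.

(** Uniqueness of the exposing functional matters because [strongly_exposed] quantifies over every
    [Psi] exposing [f], while weak* continuity is known for one [Phi] only. It is also the sole
    reason for studying zeros: the L1 norm loses differentiability at an [f] that vanishes on a set
    of positive measure. The zeros are treated by real methods: Rolle's theorem and the growth [s^n]
    of the n-th derivative replace the identity principle for entire functions. Elements of the
    space are functions known only almost everywhere, so pointwise bounds and limits are taken on
    continuous representatives, and functionals must be shown to respect almost everywhere equality.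
    The obstacle in the compactness step is mass escaping to infinity. It threatens the vanishing of
    the transform outside the band, since a cosine does not decay; averaging over frequencies beyond
    the band repairs this. It also threatens the norm of the limit [g]; here [Phi g = 1] forces norm
    1, and this value survives the limit because weak* neighbourhoods are tested by functions
    vanishing at infinity. *)

Section RealIntegrals.
Variable R : realType.
Local Notation leb := (@lebesgue_measure R).
Implicit Types (h m f g : R -> R) (a b : R).

(** * Integrals of real functions: domination, primitives, Fubini on a strip *)

Definition L1 h : Prop := leb.-integrable setT (EFin \o h).

Lemma aeS (P Q : R -> Prop) : (forall x, P x -> Q x) ->
  {ae leb, forall x, P x} -> {ae leb, forall x, Q x}.
Proof. exact: (@filterS _ _ (ae_filter_ringOfSetsType leb)). Qed.

Lemma aeI (P Q : R -> Prop) : {ae leb, forall x, P x} ->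
  {ae leb, forall x, Q x} -> {ae leb, forall x, P x /\ Q x}.
Proof. exact: (@filterI _ _ (ae_filter_ringOfSetsType leb)). Qed.

Lemma L1_measurable h : L1 h -> measurable_fun setT h.
Proof. by move=> /(@measurable_int _ _ _ leb) /measurable_EFinP. Qed.

Lemma L1D h g : L1 h -> L1 g -> L1 (fun x => h x + g x).
Proof. by move=> ih ig; exact: (integrableD measurableT ih ig). Qed.

Lemma L1B h g : L1 h -> L1 g -> L1 (fun x => h x - g x).
Proof. by move=> ih ig; exact: (integrableB measurableT ih ig). Qed.

Lemma L1Z (k : R) h : L1 h -> L1 (fun x => k * h x).
Proof. by move=> ih; exact: (integrableZl measurableT k ih). Qed.

Lemma L1_norm h : L1 h -> L1 (fun x => `|h x|).
Proof. by move=> ih; exact: (integrable_abse ih). Qed.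

Lemma L1_le h g : measurable_fun setT h -> (forall x, `|h x| <= g x) ->
  L1 g -> L1 h.
Proof.
move=> mh hg ig; apply: le_integrable ig => //.
  exact/measurable_EFinP.
move=> x _ /=; rewrite lee_fin; apply: le_trans (hg x) _; exact: ler_norm.
Qed.

Lemma L1_mulb h m (C : R) : L1 h -> measurable_fun setT m ->
  (forall x, `|m x| <= C) -> L1 (fun x => h x * m x).
Proof.
move=> ih mm mC; apply: (@L1_le _ (fun x => C * `|h x|)).
- by apply: measurable_funM => //; exact: L1_measurable.
- by move=> x; rewrite normrM mulrC ler_wpM2r.
- exact/L1Z/L1_norm.
Qed.

Lemma Rintegral_mulb_le h m (C : R) : L1 h -> measurable_fun setT m ->
  (forall x, `|m x| <= C) ->
  `|\int[leb]_x (h x * m x)| <= C * \int[leb]_x `|h x|.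
Proof.
move=> ih mm mC; have ihm := L1_mulb ih mm mC.
apply: le_trans (le_normr_Rintegral measurableT ihm) _.
rewrite -RintegralZl//; last exact: L1_norm.
apply: le_Rintegral => //; [exact: L1_norm|exact/L1Z/L1_norm|].
by move=> x _; rewrite normrM mulrC ler_wpM2r.
Qed.

Lemma integrable_itv_bounded f a b (C : R) : measurable_fun `[a, b] f ->
  (forall x, x \in `[a, b] -> `|f x| <= C) ->
  leb.-integrable `[a, b] (EFin \o f).
Proof.
move=> mf fC; apply: (@le_integrable _ _ _ leb _ _ _ (cst C%:E)) => //.
- exact/measurable_EFinP.
- by move=> x xab /=; rewrite lee_fin; apply: le_trans (fC x _) (ler_norm _).
- apply/integrableP; split; first exact: measurable_cst.
  rewrite integral_cst//= lebesgue_measure_itv/=.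
  by case: ifP => _; rewrite ?mule0//= ?EFinN -?EFinB -?EFinM ltry.
Qed.

Lemma Rintegral_itv_le f a b (C : R) : a <= b -> measurable_fun `[a, b] f ->
  (forall x, x \in `[a, b] -> `|f x| <= C) ->
  `|\int[leb]_(x in `[a, b]) f x| <= C * (b - a).
Proof.
move=> ab mf fC; have fi := integrable_itv_bounded mf fC.
apply: le_trans (le_normr_Rintegral _ fi) _ => //.
apply: (@le_trans _ _ (\int[leb]_(x in `[a, b]) C)).
  apply: le_Rintegral => //.
  - exact: (integrable_abse fi).
  - apply: (@integrable_itv_bounded _ _ _ `|C|) => //; exact: measurable_cst.
rewrite Rintegral_cst//= lebesgue_measure_itv/=.
by move: ab; rewrite le_eqVlt => /predU1P[->|ab]; rewrite ?lte_fin ?ltxx ?subrr// ab.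
Qed.

Lemma Rintegral_FTC (F f : R -> R) a b : a <= b ->
  (forall x : R, is_derive x 1 F (f x)) -> continuous f ->
  \int[leb]_(x in `[a, b]) f x = F b - F a.
Proof.
rewrite le_eqVlt => /predU1P[->|ab] dF cf.
  by rewrite set_itv1 Rintegral_set1 subrr.
have cF : continuous F.
  by move=> x; apply/differentiable_continuous/derivable1_diffP; have [] := dF x.
rewrite /Rintegral (@continuous_FTC2 _ f F a b ab)//.
- by apply: continuous_subspaceT.
- split.
  + by move=> x _; have [] := dF x.
  + exact/cvg_at_right_filter/cF.
  + exact/cvg_at_left_filter/cF.
- by move=> x _; rewrite derive1E; apply: derive_val.
Qed.

Lemma dominated_cvg_Rintegral (f_ : nat -> R -> R) f g :
  (forall n, measurable_fun setT (f_ n)) -> measurable_fun setT f ->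
  {ae leb, forall x, f_ ^~ x @ \oo --> f x} -> L1 g ->
  (forall n x, `|f_ n x| <= g x) ->
  (fun n => \int[leb]_x f_ n x) @ \oo --> \int[leb]_x f x.
Proof.
move=> mf_ mf ff ig fg.
have H1 : {ae leb, forall x, setT x -> (EFin \o f_ n) x @[n --> \oo] --> (EFin \o f) x}.
  by apply: aeS ff => x fx _; exact: cvg_comp fx _.
have H2 : {ae leb, forall x n, setT x -> (`|(EFin \o f_ n) x| <= (EFin \o g) x)%E}.
  by apply: aeW => x n _ /=; rewrite lee_fin.
have [||fi _ H] := @dominated_convergence _ _ R leb setT measurableT
  (fun n => EFin \o f_ n) (EFin \o f) (EFin \o g) _ _ H1 ig H2.
- by move=> n; apply/measurable_EFinP; exact: mf_.
- exact/measurable_EFinP.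
apply: fine_cvg; rewrite fineK//.
exact: (integrable_fin_num measurableT fi).
Qed.

Section Fubini.
Variables (h : R -> R) (m : R -> R -> R) (a b C : R).
Hypothesis ab : a <= b.
Hypothesis ih : L1 h.
Hypothesis mm : measurable_fun setT (fun z : R * R => m z.1 z.2).
Hypothesis mC : forall x t, `|m x t| <= C.

(** The interval enters as an indicator, so that both variables run over the whole line. Then [|F|]
    is at most [C |h x|] on the strip, with integral at most [C (b - a)] times the norm of [h]. *)
Let F (z : measurableTypeR R * measurableTypeR R) : \bar R :=
  (h z.1 * m z.1 z.2 * \1_(`[a, b]%classic : set R) z.2)%:E.

Let C0 : 0 <= C. Proof. exact: le_trans (normr_ge0 _) (mC 0 0). Qed.

Let mF : measurable_fun setT F.
Proof.
apply/measurable_EFinP; apply: measurable_funM; first apply: measurable_funM => //.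
  by apply: measurableT_comp (L1_measurable ih) _; exact: measurable_fst.
by apply: measurableT_comp; last exact: measurable_snd.
Qed.

Let iF : (leb \x leb)%E.-integrable setT F.
Proof.
apply/(@integrable12ltyP _ _ _ _ _ leb leb _ mF).
apply: (@le_lt_trans _ _ (\int[leb]_x (C * (b - a) * `|h x|)%:E)%E); last first.
  exact: (integrable_lty measurableT (L1Z (C * (b - a)) (L1_norm ih))).
have key x : (\int[leb]_y `|F (x, y)| <= (C * (b - a) * `|h x|)%:E)%E.
  apply: (@le_trans _ _ (\int[leb]_(y in `[a, b]%classic) (cst (C * `|h x|)%:E y))%E).
    rewrite [leRHS]integral_mkcond; apply: ge0_le_integral => //.
    - apply: measurableT_comp => //; apply: measurableT_comp mF _.
      exact: measurable_pair1.
    - apply/(measurable_restrictT _ _).1 => //; exact: measurable_cst.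
    - move=> y _ /=; rewrite patchE /F /= indicE.
      case: (y \in _) => /=; rewrite ?mulr1 ?mulr0 ?normr0 ?lee_fin//.
      by rewrite normrM mulrC ler_wpM2r.
  rewrite integral_cst//= lebesgue_measure_itv/=.
  move: ab; rewrite le_eqVlt => /predU1P[->|ab'].
    by rewrite lte_fin ltxx mule0 subrr mulr0 mul0r.
  by rewrite lte_fin ab' EFinN -EFinB -EFinM lee_fin mulrAC.
apply: ge0_le_integral => //.
- by move=> x _; apply: integral_ge0.
- apply: (@measurable_fun_fubini_tonelli_F _ _ _ _ _ leb (abse \o F)).
    exact: measurableT_comp.
  by move=> x; exact: abse_ge0.
- apply/measurable_EFinP/measurable_funM => //.
  by apply: measurableT_comp => //; exact: L1_measurable.
Qed.

Let m1 x : measurable_fun setT (m x).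
Proof. exact: (measurableT_comp mm (measurable_pair1 x)). Qed.

Let m2 t : measurable_fun setT (m^~ t).
Proof. exact: (measurableT_comp mm (measurable_pair2 t)). Qed.

Let E1 x : (\int[leb]_t F (x, t))%E =
  (h x * \int[leb]_(t in `[a, b]) m x t)%:E.
Proof.
have im : leb.-integrable `[a, b] (EFin \o m x).
  by apply: (@integrable_itv_bounded _ _ _ C) => //; exact: measurable_funTS.
rewrite -RintegralZl// /Rintegral fineK; last first.
  apply: integrable_fin_num => //.
  exact: (integrableZl _ (h x) im).
rewrite [RHS]integral_mkcond; apply: eq_integral => t _.
by rewrite patchE /F /= indicE; case: (_ \in _); rewrite ?mulr1 ?mulr0.
Qed.

Let E2 t : (\int[leb]_x F (x, t))%E =
  ((fun t => \int[leb]_x (h x * m x t)) \_ `[a, b] t)%:E.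
Proof.
rewrite patchE /F /= indicE; case: (t \in _) => /=; last first.
  by under eq_integral do rewrite mulr0; rewrite integral0.
under eq_integral do rewrite mulr1.
rewrite /Rintegral fineK//; apply: integrable_fin_num => //.
exact: L1_mulb (mC^~ t).
Qed.

Lemma Rintegral_fubini :
  \int[leb]_x (h x * \int[leb]_(t in `[a, b]) m x t) =
  \int[leb]_(t in `[a, b]) \int[leb]_x (h x * m x t).
Proof.
rewrite [RHS]Rintegral_mkcond /Rintegral.
under eq_integral do rewrite -E1.
under [in RHS]eq_integral do rewrite -E2.
by rewrite (Fubini iF).
Qed.

End Fubini.

End RealIntegrals.

(** * Mean value estimates and Rolle's theorem along a list of zeros *)

Section Derivatives.
Variable R : realType.
Implicit Types (f g : R -> R) (x a b k c : R).

Lemma is_deriveZ1 f x k a : is_derive x 1 f a ->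
  is_derive x 1 (fun y => k * f y) (k * a).
Proof. by move=> df; exact: (is_deriveZ k df). Qed.

Lemma is_derive_cos_affine k c x :
  is_derive x 1 (fun y => cos (y * k + c)) (- sin (x * k + c) * k).
Proof.
by apply: is_derive_eq; rewrite scaler0 add0r addr0 /GRing.scale /= mulr1.
Qed.

Lemma is_derive_sin_affine k c x :
  is_derive x 1 (fun y => sin (y * k + c)) (cos (x * k + c) * k).
Proof.
by apply: is_derive_eq; rewrite scaler0 add0r addr0 /GRing.scale /= mulr1.
Qed.

Lemma is_derive_continuous f (f' : R -> R) :
  (forall x : R, is_derive x 1 f (f' x)) -> continuous f.
Proof.
move=> df x; apply/differentiable_continuous/derivable1_diffP.
by have [] := df x.
Qed.

Lemma is_derive_lipschitz_in f (f' : R -> R) a b (K : R) :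
  (forall x : R, is_derive x 1 f (f' x)) ->
  (forall x, x \in `[a, b] -> `|f' x| <= K) ->
  forall x y, x \in `[a, b] -> y \in `[a, b] -> `|f x - f y| <= K * `|x - y|.
Proof.
move=> df dK.
have wlg x y : x \in `[a, b] -> y \in `[a, b] -> x <= y ->
    `|f y - f x| <= K * `|y - x|.
  move=> xab yab xy.
  have [|c cxy ->] := @MVT_segment _ f f' x y xy.
    exact/continuous_subspaceT/is_derive_continuous.
  rewrite normrM ler_wpM2r// dK//.
  move: xab yab cxy; rewrite !in_itv /= => /andP[ax _] /andP[_ yb] /andP[xc cy].
  by rewrite (le_trans ax xc) (le_trans cy yb).
move=> x y xab yab; have [xy|/ltW yx] := leP x y; last exact: wlg.
by rewrite distrC [X in _ * X]distrC; exact: wlg.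
Qed.

Lemma is_derive_lipschitz f (f' : R -> R) (K : R) :
  (forall x : R, is_derive x 1 f (f' x)) -> (forall x, `|f' x| <= K) ->
  forall x y, `|f x - f y| <= K * `|x - y|.
Proof.
move=> df dK x y.
apply: (@is_derive_lipschitz_in f f' (Num.min x y) (Num.max x y)) => //;
  by rewrite in_itv /= ge_min le_max lexx ?orbT.
Qed.

(** Rolle between neighbours of [z :: s]. The head [z] survives only as a strict lower bound of the
    new zeros and [last z s] as an upper bound: both keep the new zeros in the same interval when
    the lemma is iterated. *)
Lemma rolle_path f (f' : R -> R) (z : R) (s : seq R) :
  (forall x : R, is_derive x 1 f (f' x)) ->
  path <%R z s -> f z = 0 -> (forall x, x \in s -> f x = 0) ->
  exists s', [/\ size s' = size s, path <%R z s', all (<= last z s) s' &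
    forall x, x \in s' -> f' x = 0].
Proof.
move=> df; elim: s z => [|w s IH] z /=; first by move=> _ _ _; exists [::].
move=> /andP[zw ws] fz fs.
have fw : f w = 0 by apply: fs; rewrite mem_head.
have [|||c] := @Rolle _ f z w zw.
- by move=> x _; have [] := df x.
- exact/continuous_subspaceT/is_derive_continuous.
- by rewrite fz fw.
rewrite in_itv /= => /andP[zc cw] fc.
have f'c : f' c = 0.
  by rewrite -(@derive_val _ _ _ _ _ _ _ (df c)) (@derive_val _ _ _ _ _ _ _ fc).
have [x xs|s' [ss' ps' al fs']] := IH w ws fw.
  by apply: fs; rewrite inE xs orbT.
exists (c :: s'); split => /=.
- by rewrite ss'.
- rewrite zc /=; case: s' ps' {ss' al fs'} => //= x s' /andP[wx ->].
  by rewrite (lt_trans cw wx).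
- rewrite al andbT; apply: (le_trans (ltW cw)).
  have : all (>= w) s by apply/allP => x xs; apply/ltW/(allP (order_path_min lt_trans ws)).
  by case/lastP: s {IH ws fs ss' al} => //= s x; rewrite all_rcons last_rcons => /andP[].
- by move=> x; rewrite inE => /predU1P[->//|]; exact: fs'.
Qed.

Lemma infinite_set_seq (E : set R) (n : nat) : infinite_set E ->
  exists s : seq R, [/\ uniq s, size s = n & forall x, x \in s -> E x].
Proof.
move=> iE; elim: n => [|n [s [us ss sE]]]; first by exists [::].
have [x Ex xs] : exists2 x, E x & x \notin s.
  apply: contrapT => nx; apply: iE.
  apply: (@sub_finite_set _ _ [set` s]); last exact: finite_seq.
  move=> x Ex /=; apply: contrapT => /negP xs; apply: nx; by exists x.
exists (x :: s); split => /=; rewrite ?xs ?ss//.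
by move=> y; rewrite inE => /predU1P[->//|]; exact: sE.
Qed.

End Derivatives.

(** * Trigonometric integrals over a bounded band: derivatives and zeros *)

Section TrigIntegrals.
Variables (R : realType) (s : R).
Hypothesis s0 : 0 <= s.
Local Notation leb := (@lebesgue_measure R).

(** The bound is asked on [[0, s]] only: this makes the class stable under multiplication by [t], at
    the cost of a factor [s]. *)
Definition bndfun (C : R -> R) (M : R) : Prop :=
  measurable_fun setT C /\ forall t, t \in `[0, s] -> `|C t| <= M.

(* Closed under differentiation: the derivative of trigint C S is
   trigint (t S) (- t C), see is_derive_trigint. *)
Definition trigint (C S : R -> R) (y : R) : R :=
  \int[leb]_(t in `[0, s]) (C t * cos (y * t) + S t * sin (y * t)).

Lemma bndfunM C M : bndfun C M -> bndfun (fun t => t * C t) (s * M).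
Proof.
move=> [mC CM]; split; first exact: measurable_funM.
move=> t t0s; rewrite normrM ler_pM ?CM//.
by move: t0s; rewrite in_itv /= => /andP[t0 ts]; rewrite ger0_norm.
Qed.

Lemma bndfunN C M : bndfun C M -> bndfun (fun t => - C t) M.
Proof.
move=> [mC CM]; split; first exact: measurableT_comp.
by move=> t ts; rewrite normrN CM.
Qed.

Lemma bndfun_ge0 C M : bndfun C M -> 0 <= M.
Proof.
move=> [_ CM]; apply: le_trans (normr_ge0 _) (CM 0 _).
by rewrite in_itv /= lexx s0.
Qed.

Section Fixed.
Variables (C S : R -> R) (M : R).
Hypotheses (bC : bndfun C M) (bS : bndfun S M).

Lemma measurable_trig y :
  measurable_fun setT (fun t => C t * cos (y * t) + S t * sin (y * t)).
Proof.
have [[mC _] [mS _]] := (bC, bS).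
have my : measurable_fun setT (fun t : R => y * t) by apply: measurable_funM.
have mc := continuous_measurable_fun (@continuous_cos R).
have ms := continuous_measurable_fun (@continuous_sin R).
by apply: measurable_funD; apply: measurable_funM => //; exact: measurableT_comp my.
Qed.

Lemma trig_le y t : t \in `[0, s] ->
  `|C t * cos (y * t) + S t * sin (y * t)| <= M *+ 2.
Proof.
move=> ts; have [[_ CM] [_ SM]] := (bC, bS).
apply: le_trans (ler_normD _ _) _; rewrite mulr2n !normrM.
by apply: lerD; rewrite -[leRHS]mulr1 ler_pM ?CM ?SM ?cos_max ?sin_max.
Qed.

Lemma integrable_trig y :
  leb.-integrable `[0, s] (EFin \o fun t => C t * cos (y * t) + S t * sin (y * t)).
Proof.
apply: (@integrable_itv_bounded _ _ _ _ (M *+ 2)).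
  apply: measurable_funTS; exact: measurable_trig.
by move=> t; exact: trig_le.
Qed.

Lemma trigint_le y : `|trigint C S y| <= M *+ 2 * s.
Proof.
rewrite -[X in _ * X]subr0; apply: Rintegral_itv_le => //.
  apply: measurable_funTS; exact: measurable_trig.
by move=> t; exact: trig_le.
Qed.

End Fixed.

(** Differentiation under the integral sign, dominated by the constant [2 s M]. Iterated, it bounds
    the n-th derivative by [2 M s * s^n], the growth of an entire function of exponential type
    [s]. *)
Lemma is_derive_trigint C S M (y : R) : bndfun C M -> bndfun S M ->
  is_derive y 1 (trigint C S) (trigint (fun t => t * S t) (fun t => - (t * C t)) y).
Proof.
move=> bC bS.
pose f (y t : R) : R := C t * cos (y * t) + S t * sin (y * t).
pose f' (y t : R) : R := t * S t * cos (y * t) + - (t * C t) * sin (y * t).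
have df (x t : R) : is_derive x 1 (f^~ t) (f' x t).
  have -> : f^~ t = fun y => C t * cos (y * t + 0) + S t * sin (y * t + 0).
    by apply/funext => z; rewrite /f addr0.
  apply: is_derive_eq; rewrite /f' /GRing.scale /= !addr0; ring.
have d1f : partial1of2 f = f'.
  apply/funext => x; apply/funext => t; rewrite partial1of2E.
  exact: (@derive_val _ _ _ _ _ _ _ (df x t)).
have Iy : `]y - 1, y + 1[%classic y.
  by rewrite /= in_itv /= ltrBlDr ltrDl ltr01.
have iG : leb.-integrable `[0, s] (EFin \o cst ((s * M) *+ 2)).
  apply: (@integrable_itv_bounded _ _ _ _ `|(s * M) *+ 2|) => //.
have G0 (t : R) : 0 <= cst ((s * M) *+ 2) t.
  by rewrite /= mulrn_wge0// mulr_ge0// (bndfun_ge0 bC).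
have int (x : R) : `]y - 1, y + 1[%classic x -> leb.-integrable `[0, s] (EFin \o f x).
  by move=> _; exact: (integrable_trig bC bS).
have der (x t : R) : `]y - 1, y + 1[%classic x -> `[0, s]%classic t -> derivable (f^~ t) x 1.
  by move=> _ _; have [] := df x t.
have dG (x t : R) : `]y - 1, y + 1[%classic x -> `[0, s]%classic t ->
    `|partial1of2 f x t| <= cst ((s * M) *+ 2) t.
  move=> _ ts; rewrite d1f.
  exact: (trig_le (bndfunM bS) (bndfunN (bndfunM bC))).
have m0s : measurable (`[0, s]%classic : set R) by exact: measurable_itv.
split.
  exact: (@derivable_under_integral _ _ _ leb f _ m0s y _ _ Iy int der _ G0 iG dG).
rewrite -derive1E.
have := @differentiation_under_integral _ _ _ leb f _ m0s y _ _ Iy int der _ G0 iG dG.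
by rewrite d1f.
Qed.

(* Rolle's theorem, iterated: each derivative loses one zero and gains a factor s. *)
Lemma trigint_zeros_le (n : nat) C S M (a b z : R) (l : seq R) :
  bndfun C M -> bndfun S M -> size l = n -> path <%R z l ->
  a <= z -> last z l <= b -> trigint C S z = 0 ->
  (forall x, x \in l -> trigint C S x = 0) ->
  forall x, x \in `[a, b] ->
    `|trigint C S x| <= M *+ 2 * s * (s * (b - a)) ^+ n.+1.
Proof.
elim: n C S M z l => [|n IH] C S M z l bC bS szl pl az lb fz fl x xab.
  have -> : M *+ 2 * s * (s * (b - a)) ^+ 1 = (s * M) *+ 2 * s * (b - a) by ring.
  move: l szl lb {pl fl} => [|//] _ /= zb.
  rewrite -[X in `|X|]subr0 -fz.
  apply: le_trans (is_derive_lipschitz (fun y => is_derive_trigint y bC bS)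
    (trigint_le (bndfunM bS) (bndfunN (bndfunM bC))) x z) _.
  rewrite ler_wpM2l//.
    by rewrite mulr_ge0// mulrn_wge0// mulr_ge0// (bndfun_ge0 bC).
  by move: xab; rewrite in_itv /= ler_norml => /andP[ax xb]; apply/andP; split; lra.
have [l' [szl' pl' al' fl']] := rolle_path (fun y => is_derive_trigint y bC bS) pl fz fl.
case: l' szl' pl' al' fl' => [|w l'] /=; first by rewrite szl.
rewrite szl => -[szl'] /andP[zw pl'] /andP[wl al'] fl'.
have K := IH _ _ _ w l' (bndfunM bS) (bndfunN (bndfunM bC)) szl' pl'
  (le_trans az (ltW zw)) _ (fl' w _) _.
have {}K : forall x, x \in `[a, b] ->
    `|trigint (fun t => t * S t) (fun t => - (t * C t)) x| <=
    s * M *+ 2 * s * (s * (b - a)) ^+ n.+1.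
  apply: K.
  - apply: le_trans lb; case/lastP: l' al' {szl' pl' fl'} => //= l' v.
    by rewrite all_rcons last_rcons => /andP[].
  - exact: mem_head.
  - by move=> v vl; apply: fl'; rewrite inE vl orbT.
have zb : z <= b.
  apply: le_trans lb; apply: le_trans (ltW zw) wl.
(* Back from the derivative to [trigint C S]: it vanishes at [z], so the bound on the derivative
   gains a factor [b - a]. *)
rewrite -[X in `|X|]subr0 -fz.
apply: le_trans (is_derive_lipschitz_in (fun y => is_derive_trigint y bC bS) K xab _) _.
  by rewrite in_itv /= az zb.
have -> : M *+ 2 * s * (s * (b - a)) ^+ n.+2 = (s * M *+ 2 * s * (s * (b - a)) ^+ n.+1) * (b - a).
  by rewrite [in LHS]exprS; ring.
have M0 := bndfun_ge0 bC.
rewrite ler_wpM2l//.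
  rewrite mulr_ge0 ?exprn_ge0//; last by rewrite mulr_ge0// subr_ge0 (le_trans az zb).
  by rewrite mulr_ge0// mulrn_wge0// mulr_ge0.
by move: xab; rewrite in_itv /= ler_norml => /andP[ax xb]; apply/andP; split; lra.
Qed.

Section Zeros.
Variables (C S : R -> R) (M : R).
Hypotheses (bC : bndfun C M) (bS : bndfun S M).
Let Z : set R := [set x | trigint C S x = 0].

Lemma trigint_local_zero (a b : R) : s * (b - a) <= 2^-1 ->
  infinite_set (`[a, b] `&` Z) -> `[a, b] `<=` Z.
Proof.
move=> sab iZ x xab.
have ab : a <= b by move: xab; rewrite /= in_itv /= => /andP[]; exact: le_trans.
have K n : `|trigint C S x| <= M *+ 2 * s * 2^-1 ^+ n.+1.
  have [l [ul sl lZ]] := infinite_set_seq n.+1 iZ.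
  have : sorted <%R (sort <=%R l) by rewrite sort_lt_sorted.
  have : size (sort <=%R l) = n.+1 by rewrite size_sort.
  have : forall y, y \in sort <=%R l -> y \in `[a, b] /\ Z y.
    by move=> y; rewrite mem_sort => /lZ[].
  case: (sort _ _) => // z l' zl [szl'] /= pl'.
  apply: le_trans (@trigint_zeros_le n C S M a b z l' bC bS szl' pl' _ _ _ _ _ xab) _.
  - by have [] := zl z (mem_head _ _); rewrite in_itv /= => /andP[].
  - by have [] := zl _ (mem_last z l'); rewrite in_itv /= => /andP[].
  - by have [] := zl z (mem_head _ _).
  - by move=> y yl; have [] := zl y; rewrite ?inE ?yl ?orbT.
  - rewrite ler_wpM2l//; last by rewrite lerXn2r// nnegrE ?mulr_ge0 ?subr_ge0.
    by rewrite mulr_ge0// mulrn_wge0// (bndfun_ge0 bC).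
have c0 : (M *+ 2 * s * 2^-1 ^+ n.+1) @[n --> \oo] --> (0 : R).
  have := @cvg_geometric R (M *+ 2 * s * 2^-1) 2^-1.
  rewrite ger0_norm// => /(_ _)/=.
  rewrite invf_lt1// ltr1n => /(_ isT).
  by apply: cvg_trans; apply: near_eq_cvg; apply: nearW => n /=; rewrite exprS mulrA.
have : `|trigint C S x| <= 0.
  rewrite -(cvg_lim _ c0)//; apply: limr_ge; first by apply/cvg_ex; exists 0.
  exact: nearW.
by rewrite normr_le0 => /eqP.
Qed.

Lemma infinite_set_itv (a b : R) : a < b -> infinite_set `[a, b]%classic.
Proof.
move=> ab fin; have := @countable_lebesgue_measure0 R _ (finite_set_countable fin).
rewrite lebesgue_measure_itv /= lte_fin ab => /eqP.
by rewrite EFinN -EFinB eqe subr_eq0 => /eqP ba; rewrite ba ltxx in ab.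
Qed.

(* Vanishing on an interval of length 2L propagates to every overlapping one. *)
Lemma trigint_zero (z : R) : limit_point Z z -> forall x, trigint C S x = 0.
Proof.
move=> /limit_point_infinite_setP zZ.
(* [L = 1 / (4 (s + 1))] gives [s * 2 L <= 1/2]; the summand 1 keeps the quotient meaningful when
   [s = 0]. *)
have [L L0 sL] : exists2 L : R, 0 < L & s * (L *+ 2) <= 2^-1.
  have s1 : 0 < s + 1 by rewrite ltr_wpDl.
  exists (4^-1 * (s + 1)^-1); first by rewrite mulr_gt0 ?invr_gt0.
  have : s / (s + 1) <= 1 by rewrite ler_pdivrMr// mul1r lerDl.
  move=> sq; have -> : s * (4^-1 / (s + 1) *+ 2) = 2^-1 * (s / (s + 1)) by field; lra.
  by rewrite -[leRHS]mulr1 ler_wpM2l.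
have step c : infinite_set (`[c - L, c + L] `&` Z) -> `[c - L, c + L] `<=` Z.
  apply: trigint_local_zero; apply: le_trans sL; rewrite le_eqVlt; apply/orP; left.
  by apply/eqP; ring.
(* A shift by at most [L] leaves an overlap of length at least [L], hence infinitely many zeros in
   the shifted interval. *)
have ext c d : `|d| <= L -> `[c - L, c + L] `<=` Z -> `[c + d - L, c + d + L] `<=` Z.
  move=> dL cZ; apply: step.
  have [d0|d0] := leP 0 d.
  - have := @infinite_set_itv (c + d - L) (c + L).
    rewrite ger0_norm// in dL.
    have -> : c + d - L < c + L by lra.
    move=> /(_ isT); apply: contra_not; apply: sub_finite_set => x /=.
    rewrite in_itv /= => /andP[x1 x2]; split; first by rewrite in_itv /=; lra.
    by apply: cZ; rewrite /= in_itv /=; lra.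
  - have := @infinite_set_itv (c - L) (c + d + L).
    rewrite ltr0_norm// in dL.
    have -> : c - L < c + d + L by lra.
    move=> /(_ isT); apply: contra_not; apply: sub_finite_set => x /=.
    rewrite in_itv /= => /andP[x1 x2]; split; first by rewrite in_itv /=; lra.
    by apply: cZ; rewrite /= in_itv /=; lra.
have base : `[z - L, z + L] `<=` Z.
  apply: step; apply: zZ; exists L => //= x /=.
  by rewrite in_itv /= ltr_norml => /andP[]; lra.
have all_ d (n : nat) : `|d| <= L -> `[z + d *+ n - L, z + d *+ n + L] `<=` Z.
  move=> dL; elim: n => [|n IH]; first by rewrite mulr0n addr0.
  by rewrite mulrSr addrA; exact: ext.
(* The way from [z] to [x] is cut into [n] equal shifts of size at most [L]. *)
move=> x; pose n := (Num.trunc (`|x - z| / L)).+1.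
have nx : `|x - z| / n%:R <= L.
  rewrite ler_pdivrMr ?ltr0n// mulrC -ler_pdivrMr//.
  by apply/ltW; rewrite truncnS_gt.
apply: (all_ ((x - z) / n%:R) n).
  by rewrite normrM normfV [`|n%:R|]ger0_norm.
have -> : (x - z) / n%:R *+ n = x - z by rewrite -[LHS]mulr_natr mulfVK ?pnatr_eq0.
by rewrite /= in_itv /=; lra.
Qed.

(** A zero that is not isolated would be a limit point of [Z], which [trigint_zero] excludes. So the
    zeros are isolated, hence countable, hence null. *)
Lemma trigint_zeros_null : (exists x, trigint C S x <> 0) ->
  {ae leb, forall x, trigint C S x <> 0}.
Proof.
move=> [x0 nx0].
have Ziso : Z `<=` isolated Z.
  move=> x Zx; apply: contrapT => niso; apply: nx0; apply: (@trigint_zero x).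
  move=> U Ux; apply: contrapT => nU; apply: niso; split; first exact/mem_set.
  exists U => //; apply/seteqP; split => y /=.
    by move=> [Uy Zy]; apply: contrapT => /eqP yx; apply: nU; exists y.
  by move=> ->; split => //; exact: nbhs_singleton.
have cZ : countable Z by apply: sub_countable (countable_isolated Z); exact: subset_card_le.
exists Z; split.
- exact: countable_measurable.
- exact: countable_lebesgue_measure0.
- by move=> x /= /contrapT.
Qed.

End Zeros.

End TrigIntegrals.

(** * Fourier inversion for integrable band-limited functions *)

Section Inversion.
Variable R : realType.
Local Notation leb := (@lebesgue_measure R).
Implicit Types (h f : R -> R).

(** For real [h] the transforms at [t] and [- t] carry the same information, so only [t > s] is
    asked. The free phase covers the cosine transform, [c = 0], the sine transform, [c = - pi / 2],
    and the shifts of [cosT_sinT_shift]. *)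
Definition bandlimited (s : R) h : Prop :=
  L1 h /\ forall t c : R, s < t -> \int[leb]_x (h x * cos (x * t + c)) = 0.

Definition cosT h (t : R) : R := \int[leb]_x (h x * cos (x * t)).
Definition sinT h (t : R) : R := \int[leb]_x (h x * sin (x * t)).

Lemma measurable_affine (k c : R) : measurable_fun setT (fun x : R => x * k + c).
Proof. by apply: measurable_funD => //; exact: measurable_funM. Qed.

Lemma measurable_cos (k c : R) : measurable_fun setT (fun x : R => cos (x * k + c)).
Proof.
apply: (measurableT_comp (continuous_measurable_fun (@continuous_cos R))).
exact: measurable_affine.
Qed.

Lemma measurable_sin (k c : R) : measurable_fun setT (fun x : R => sin (x * k + c)).
Proof.
apply: (measurableT_comp (continuous_measurable_fun (@continuous_sin R))).
exact: measurable_affine.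
Qed.

Lemma L1_cos h (k c : R) : L1 h -> L1 (fun x => h x * cos (x * k + c)).
Proof. by move=> ih; apply: (L1_mulb ih (measurable_cos k c)) => x; exact: cos_max. Qed.

Lemma L1_sin h (k c : R) : L1 h -> L1 (fun x => h x * sin (x * k + c)).
Proof. by move=> ih; apply: (L1_mulb ih (measurable_sin k c)) => x; exact: sin_max. Qed.

Lemma L1_cosM h (k : R) : L1 h -> L1 (fun x => h x * cos (x * k)).
Proof. by move=> /(L1_cos k 0); under eq_fun do rewrite addr0. Qed.

Lemma L1_sinM h (k : R) : L1 h -> L1 (fun x => h x * sin (x * k)).
Proof. by move=> /(L1_sin k 0); under eq_fun do rewrite addr0. Qed.

Lemma continuous_mulb_integral h (m : R -> R -> R) : L1 h ->
  (forall t, measurable_fun setT (m t)) -> (forall t x, `|m t x| <= 1) ->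
  (forall x, continuous (m^~ x)) ->
  continuous (fun t => \int[leb]_x (h x * m t x)).
Proof.
move=> ih mm m1 mc t.
apply: (@continuity_under_integral _ _ _ leb (fun t x => h x * m t x) setT
  measurableT (t - 1) (t + 1) _ _ (fun x => `|h x|)).
- by move=> u _; exact: (L1_mulb ih (mm u)).
- apply: aeW => x _ u _; apply: cvgM; [exact: cvg_cst|exact: mc].
- exact: L1_norm.
- by move=> u _; apply: aeW => x _; rewrite normrM ler_piMr.
- by rewrite inE /= in_itv /= ltrBlDr ltrDl ltr01.
Qed.

Lemma continuous_cosT h : L1 h -> continuous (cosT h).
Proof.
move=> ih; apply: continuous_mulb_integral => //.
- by move=> t; have := measurable_cos t 0; under eq_fun do rewrite addr0.
- by move=> t x; exact: cos_max.
- move=> x t; apply: (@continuous_comp _ _ _ (fun t => x * t) cos); last exact: continuous_cos.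
  exact: mulrl_continuous.
Qed.

Lemma continuous_sinT h : L1 h -> continuous (sinT h).
Proof.
move=> ih; apply: continuous_mulb_integral => //.
- by move=> t; have := measurable_sin t 0; under eq_fun do rewrite addr0.
- by move=> t x; exact: sin_max.
- move=> x t; apply: (@continuous_comp _ _ _ (fun t => x * t) sin); last exact: continuous_sin.
  exact: mulrl_continuous.
Qed.

Lemma bndfun_cosT s h : L1 h -> bndfun s (cosT h) (\int[leb]_x `|h x|).
Proof.
move=> ih; split.
  by apply: continuous_measurable_fun; exact: continuous_cosT.
move=> t _; rewrite -[leRHS]mul1r; apply: Rintegral_mulb_le => //.
  by have := measurable_cos t 0; under eq_fun do rewrite addr0.
by move=> x; exact: cos_max.
Qed.

Lemma bndfun_sinT s h : L1 h -> bndfun s (sinT h) (\int[leb]_x `|h x|).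
Proof.
move=> ih; split.
  by apply: continuous_measurable_fun; exact: continuous_sinT.
move=> t _; rewrite -[leRHS]mul1r; apply: Rintegral_mulb_le => //.
  by have := measurable_sin t 0; under eq_fun do rewrite addr0.
by move=> x; exact: sin_max.
Qed.

(** Writes the integrand of [trigint] as one integral against [h]. In this form the order of
    integration can be exchanged, and for [t] beyond the band the value is 0. *)
Lemma cosT_sinT_shift h (t y : R) : L1 h ->
  \int[leb]_x (h x * cos (x * t + - (y * t))) =
  cosT h t * cos (y * t) + sinT h t * sin (y * t).
Proof.
move=> ih.
have ic := L1_cosM t ih; have is_ := L1_sinM t ih.
rewrite /cosT /sinT -!RintegralZr//.
rewrite -RintegralD//; first last.
- by apply: (@L1_mulb _ _ (cst (sin (y * t))) 1) => // x; exact: sin_max.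
- by apply: (@L1_mulb _ _ (cst (cos (y * t))) 1) => // x; exact: cos_max.
by apply: eq_Rintegral => x _; rewrite cosB; ring.
Qed.

(** Poisson kernel of the half-plane without its factor [1 / pi]; its total mass is pi, the origin
    of the constant in [bl_rep]. *)
Definition poisson (e u : R) : R := e / (e ^+ 2 + u ^+ 2).

Lemma continuous_expRM (k : R) : continuous (fun t : R => expR (k * t)).
Proof.
move=> t; apply: (@continuous_comp _ _ _ (fun t => k * t) (@expR R)).
  exact: mulrl_continuous.
exact: continuous_expR.
Qed.

Lemma Rintegral_expR_cos (e u T : R) : 0 < e -> 0 <= T ->
  \int[leb]_(t in `[0, T]) (expR (- e * t) * cos (t * u)) =
  poisson e u + expR (- e * T) * (u * sin (T * u) - e * cos (T * u)) / (e ^+ 2 + u ^+ 2).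
Proof.
move=> e0 T0.
have d0 : e ^+ 2 + u ^+ 2 != 0 by rewrite gt_eqF// ltr_wpDr ?sqr_ge0 ?exprn_gt0.
(* The real part of [exp ((- e + i u) t) / (- e + i u)]; its value at 0 is [- poisson e u]. *)
pose F (t : R) := expR (- e * t) * (u * sin (t * u) - e * cos (t * u)) / (e ^+ 2 + u ^+ 2).
have dF (t : R) : is_derive t 1 F (expR (- e * t) * cos (t * u)).
  by apply: is_derive_eq; rewrite /GRing.scale /=; field.
have cf : continuous (fun t : R => expR (- e * t) * cos (t * u)).
  have cc : continuous (fun t : R => cos (t * u)).
    apply: (@is_derive_continuous _ _ (fun t => - sin (t * u) * u)) => t.
    by apply: is_derive_eq; rewrite /GRing.scale /=; ring.
  by move=> t; apply: cvgM; [exact: continuous_expRM|exact: cc].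
by rewrite (Rintegral_FTC T0 dF cf) /F mulr0 mul0r sin0 cos0 expR0 /poisson; field.
Qed.

Lemma poisson_denom_gt0 (e u : R) : 0 < e -> 0 < e ^+ 2 + u ^+ 2.
Proof. by move=> e0; rewrite ltr_wpDr ?sqr_ge0 ?exprn_gt0. Qed.

Lemma poisson_le (e u : R) : 0 < e -> `|poisson e u| <= e^-1.
Proof.
move=> e0; have d0 := poisson_denom_gt0 u e0.
rewrite ger0_norm /poisson; last by rewrite divr_ge0// ltW.
rewrite ler_pdivrMr// mulrDr expr2 mulKf ?gt_eqF// lerDl.
by rewrite mulr_ge0 ?sqr_ge0// invr_ge0 ltW.
Qed.

Lemma measurable_poisson (e : R) : 0 < e -> measurable_fun setT (poisson e).
Proof.
move=> e0; apply: continuous_measurable_fun => u.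
apply: cvgM; first exact: cvg_cst.
apply: cvgV; first by rewrite gt_eqF// poisson_denom_gt0.
by apply: cvgD; [exact: cvg_cst|exact: exprn_continuous].
Qed.

Lemma Rintegral_poisson (e x a b : R) : 0 < e -> a <= b ->
  \int[leb]_(y in `[a, b]) poisson e (y - x) =
  atan ((b - x) / e) - atan ((a - x) / e).
Proof.
move=> e0 ab.
have dF (y : R) : is_derive y 1 (fun y => atan ((y - x) / e)) (poisson e (y - x)).
  have d0 := poisson_denom_gt0 (y - x) e0.
  apply: is_derive_eq; rewrite /GRing.scale /= /poisson.
  field; apply/andP; split; first by rewrite gt_eqF.
  by rewrite gt_eqF.
have cf : continuous (fun y => poisson e (y - x)).
  move=> y; apply: cvgM; first exact: cvg_cst.
  apply: cvgV; first by rewrite gt_eqF// poisson_denom_gt0.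
  apply: cvgD; first exact: cvg_cst.
  apply: (@continuous_comp _ _ _ (fun y => y - x) (fun u : R => u ^+ 2)).
    by apply: cvgB; [exact: cvg_id|exact: cvg_cst].
  exact: exprn_continuous.
exact: (Rintegral_FTC ab dF cf).
Qed.

Lemma cvg_atan_scale (c : R) : 0 < c ->
  atan (c / n.+1%:R^-1) @[n --> \oo] --> (pi / 2 : R).
Proof.
move=> c0; apply: cvg_comp (@cvgy_atan R).
have -> : (fun n : nat => c / n.+1%:R^-1) = (fun n => c * n.+1%:R).
  by apply/funext => n; rewrite invrK.
apply/cvgryPge => A.
near=> n; rewrite mulrC -ler_pdivrMr//.
apply: le_trans (_ : n%:R <= _); last by rewrite ler_nat.
by near: n; exact: nbhs_infty_ger.
Unshelve. all: end_near. Qed.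

Lemma cvg_atan_scaleN (c : R) : c < 0 ->
  atan (c / n.+1%:R^-1) @[n --> \oo] --> (- (pi / 2) : R).
Proof.
move=> c0; have nc0 : 0 < - c by rewrite oppr_gt0.
have -> : (fun n : nat => atan (c / n.+1%:R^-1)) = (fun n => - atan (- c / n.+1%:R^-1)).
  by apply/funext => n; rewrite mulNr atanN opprK.
by apply: cvgN; exact: cvg_atan_scale.
Qed.

Section Abel.
Variables (s : R) (h : R -> R).
Hypotheses (s0 : 0 <= s) (bh : bandlimited s h).
Let ih : L1 h := bh.1.
Let N := \int[leb]_x `|h x|.

Let N0 : 0 <= N. Proof. by apply: Rintegral_ge0 => x _. Qed.

(** The absolute value keeps the damping factor at most 1 on the whole line, as the global bound in
    [Rintegral_fubini] demands; on [[0, T]] it is [exp (- e t)]. *)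
Let damp (e : R) (f : R -> R) (t : R) := expR (- e * `|t|) * f t.

Let damp1 (e t : R) : 0 < e -> expR (- e * `|t|) <= 1.
Proof. by move=> e0; rewrite -expR0 ler_expR mulNr oppr_le0 mulr_ge0// ltW. Qed.

Let measurable_damp (e : R) : measurable_fun setT (fun t : R => expR (- e * `|t|)).
Proof.
apply: (measurableT_comp (@measurable_expR R)).
by apply: measurable_funM => //; exact: measurable_normr.
Qed.

Let bndfun_damp (e T : R) f : 0 < e -> bndfun T f N -> bndfun T (damp e f) N.
Proof.
move=> e0 [mf fN]; split; first by apply: measurable_funM => //; exact: measurable_damp.
move=> t tT; rewrite normrM -[leRHS]mul1r ler_pM ?fN//.
by rewrite ger0_norm ?expR_ge0 ?damp1.
Qed.

Let damped_fubini (e T y : R) : 0 < e -> 0 <= T ->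
  trigint T (damp e (cosT h)) (damp e (sinT h)) y =
  \int[leb]_x (h x * \int[leb]_(t in `[0, T]) (expR (- e * `|t|) * cos (x * t + - (y * t)))).
Proof.
move=> e0 T0; rewrite (@Rintegral_fubini _ h _ 0 T 1 T0 ih).
- apply: eq_Rintegral => t _.
  transitivity (expR (- e * `|t|) * \int[leb]_x (h x * cos (x * t + - (y * t)))).
    by rewrite cosT_sinT_shift// /damp; ring.
  rewrite -RintegralZl//; last exact: L1_cos.
  by apply: eq_Rintegral => x _; ring.
- apply: measurable_funM.
    exact: (measurableT_comp (measurable_damp e) measurable_snd).
  apply: (measurableT_comp (continuous_measurable_fun (@continuous_cos R))).
  apply: measurable_funD; first by apply: measurable_funM; [exact: measurable_fst|exact: measurable_snd].
  apply: measurableT_comp => //.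
  by apply: measurable_funM => //; exact: measurable_snd.
- move=> x t; rewrite normrM -[leRHS]mul1r ler_pM ?cos_max//.
  by rewrite ger0_norm ?expR_ge0 ?damp1.
Qed.

(** Here the band limit enters the inversion: beyond [s] the integrand is [exp (- e t)] times an
    integral of [h] against a shifted cosine of frequency [t], which is 0. *)
Let damped_support (e T y : R) : 0 < e -> s <= T ->
  trigint T (damp e (cosT h)) (damp e (sinT h)) y =
  trigint s (damp e (cosT h)) (damp e (sinT h)) y.
Proof.
move=> e0 sT; have T0 := le_trans s0 sT.
have bC := bndfun_damp e0 (bndfun_cosT T ih).
have bS := bndfun_damp e0 (bndfun_sinT T ih).
apply/eqP; rewrite -subr_eq0; apply/eqP; rewrite /trigint.
rewrite (Rintegral_itvB (integrable_trig bC bS y))//.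
transitivity (\int[leb]_(x in `]s, T]) (0 : R)).
  apply: eq_Rintegral => t; rewrite inE /= in_itv /= => /andP[st _].
  have := bh.2 t (- (y * t)) st; rewrite cosT_sinT_shift// => H.
  have -> : damp e (cosT h) t * cos (y * t) + damp e (sinT h) t * sin (y * t) =
    expR (- e * `|t|) * (cosT h t * cos (y * t) + sinT h t * sin (y * t)).
    by rewrite /damp; ring.
  by rewrite H mulr0.
by rewrite Rintegral_cst//= mul0r.
Qed.

(** By [e |u| <= e^2 + u^2] the bound is uniform in [u], so the boundary term integrated against [h]
    decays like [exp (- e T)]. *)
Let damped_kernel (e T u : R) : 0 < e ->
  `|expR (- e * T) * (u * sin (T * u) - e * cos (T * u)) / (e ^+ 2 + u ^+ 2)|
  <= expR (- e * T) * (2 / e).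
Proof.
move=> e0; have d0 := poisson_denom_gt0 u e0.
rewrite -mulrA normrM ger0_norm ?expR_ge0// ler_wpM2l ?expR_ge0//.
rewrite normrM normfV [`|e ^+ 2 + _|]gtr0_norm// ler_pdivrMr//.
apply: (@le_trans _ _ (`|u| + e)).
  apply: le_trans (ler_normB _ _) _; rewrite !normrM [`|e|]gtr0_norm//.
  by apply: lerD; rewrite ler_piMr ?sin_max ?cos_max// ltW.
rewrite mulrAC ler_pdivlMr// -[u ^+ 2]real_normK ?num_real//.
by have := normr_ge0 u; nra.
Qed.

Let rem (e T u : R) := expR (- e * T) * (u * sin (T * u) - e * cos (T * u)) / (e ^+ 2 + u ^+ 2).

Let measurable_rem (e T : R) : 0 < e -> measurable_fun setT (rem e T).
Proof.
move=> e0; have -> : rem e T = fun u => expR (- e * T) * (u * sin (T * u) - e * cos (T * u)) * (poisson e u * e^-1).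
  apply/funext => u; rewrite /rem /poisson; congr (_ * _).
  by rewrite [e / _]mulrC mulfK ?gt_eqF.
have mT : measurable_fun setT (fun u : R => T * u) by apply: measurable_funM.
have mc := continuous_measurable_fun (@continuous_cos R).
have ms := continuous_measurable_fun (@continuous_sin R).
apply: measurable_funM; last by apply: measurable_funM => //; exact: measurable_poisson.
apply: measurable_funM => //; apply: measurable_funB; apply: measurable_funM => //.
  exact: measurableT_comp ms mT.
exact: measurableT_comp mc mT.
Qed.

(* The damped integral over [0, T] does not depend on T >= s; let T -> +oo. *)
Let abel_poisson (e y : R) : 0 < e ->
  trigint s (damp e (cosT h)) (damp e (sinT h)) y =
  \int[leb]_x (h x * poisson e (y - x)).
Proof.
move=> e0.
have my : measurable_fun setT (fun x : R => y - x) by exact: measurable_funB.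
have mP : measurable_fun setT (fun x : R => poisson e (y - x)).
  exact: measurableT_comp (measurable_poisson e0) my.
have K T : s <= T ->
  `|trigint s (damp e (cosT h)) (damp e (sinT h)) y - \int[leb]_x (h x * poisson e (y - x))|
  <= expR (- e * T) * (2 / e) * N.
  move=> sT; have T0 := le_trans s0 sT.
  have mr : measurable_fun setT (fun x : R => rem e T (y - x)).
    exact: measurableT_comp (measurable_rem T e0) my.
  rewrite -(damped_support y e0 sT) damped_fubini//.
  have -> : \int[leb]_x (h x * \int[leb]_(t in `[0, T]) (expR (- e * `|t|) * cos (x * t + - (y * t))))
    = \int[leb]_x (h x * poisson e (y - x) + h x * rem e T (y - x)).
    apply: eq_Rintegral => x _; rewrite -mulrDr -Rintegral_expR_cos//; congr (_ * _).
    apply: eq_Rintegral => t; rewrite inE /= in_itv /= => /andP[t0 _].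
    rewrite (ger0_norm t0); congr (_ * _).
    by rewrite -cosN; congr cos; ring.
  rewrite RintegralD//; first last.
  - by apply: (L1_mulb ih mr) => x; exact: damped_kernel.
  - by apply: (L1_mulb ih mP) => x; exact: poisson_le.
  rewrite addrAC subrr add0r.
  by apply: (Rintegral_mulb_le ih mr) => x; exact: damped_kernel.
apply/eqP; rewrite -subr_eq0 -normr_le0 leNgt; apply/negP.
set D := `|_ - _| in K *; move=> D0.
(* If [D > 0], then [D exp (e T) <= q] for all [T >= s]. The choice [T = s + q / (D e)] contradicts
   this, since [exp (e T) >= 1 + e T] makes the left side exceed [q]. *)
pose q := 2 / e * N; have q0 : 0 <= q by rewrite mulr_ge0// divr_ge0// ltW.
have := K (s + (q / D) / e); rewrite lerDl divr_ge0 ?divr_ge0 ?(ltW D0) ?(ltW e0)// => /(_ isT).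
rewrite -mulrA -/q mulNr expRN mulrC ler_pdivlMr ?expR_gt0// leNgt => /negP; apply.
apply: (@lt_le_trans _ _ (D * (1 + e * (s + q / D / e)))); last first.
  by rewrite ler_wpM2l ?(ltW D0)// expR_ge1Dx.
have -> : D * (1 + e * (s + q / D / e)) = q + D * (1 + e * s).
  by field; rewrite !gt_eqF.
by rewrite ltrDl mulr_gt0// ltr_wpDr// mulr_ge0// ltW.
Qed.

(** Integrating in [y] before [e] tends to 0 replaces the kernel, whose maximum is [1 / e], by a
    difference of arctangents bounded by pi for every [e]. Dominated convergence becomes available
    without a study of approximate identities. *)
Let abel_integrated (e a b : R) : 0 < e -> a <= b ->
  \int[leb]_(y in `[a, b]) trigint s (damp e (cosT h)) (damp e (sinT h)) y =
  \int[leb]_x (h x * (atan ((b - x) / e) - atan ((a - x) / e))).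
Proof.
move=> e0 ab.
have -> : \int[leb]_(y in `[a, b]) trigint s (damp e (cosT h)) (damp e (sinT h)) y =
   \int[leb]_(y in `[a, b]) \int[leb]_x (h x * poisson e (y - x)).
  by apply: eq_Rintegral => y _; exact: abel_poisson.
rewrite -(@Rintegral_fubini _ h (fun x y => poisson e (y - x)) a b e^-1 ab ih).
- by apply: eq_Rintegral => x _; rewrite Rintegral_poisson.
- apply: (measurableT_comp (measurable_poisson e0)).
  by apply: measurable_funB; [exact: measurable_snd|exact: measurable_fst].
- by move=> x t; exact: poisson_le.
Qed.

(** On [[0, s]] one has [1 - exp (- e t) <= e t <= e s], so removing the damping costs O(e),
    uniformly in [y]. *)
Let undamp (e y : R) : 0 < e ->
  `|trigint s (damp e (cosT h)) (damp e (sinT h)) y - trigint s (cosT h) (sinT h) y|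
  <= (e * s * N) *+ 2 * s.
Proof.
move=> e0.
have bC := bndfun_cosT s ih; have bS := bndfun_sinT s ih.
have dC := bndfun_damp e0 bC; have dS := bndfun_damp e0 bS.
have b f : bndfun s f N -> bndfun s (fun t => damp e f t - f t) (e * s * N).
  move=> [mf fN]; have [mdf _] := bndfun_damp e0 (conj mf fN).
  split; first exact: measurable_funB.
  move=> t ts; rewrite /damp -{2}[f t]mul1r -mulrBl normrM ler_pM ?fN//.
  move: ts; rewrite in_itv /= => /andP[t0 ts].
  rewrite distrC ger0_norm ?subr_ge0 ?damp1// (ger0_norm t0).
  have := expR_ge1Dx (- e * t); have : e * t <= e * s by rewrite ler_wpM2l// ltW.
  by lra.
have := trigint_le s0 (b _ bC) (b _ bS) y; congr (`|_| <= _).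
rewrite /trigint -RintegralB//; [|exact: integrable_trig dC dS y|exact: integrable_trig bC bS y].
by apply: eq_Rintegral => t _; ring.
Qed.

Let continuous_trigint C S : bndfun s C N -> bndfun s S N -> continuous (trigint s C S).
Proof.
by move=> bC bS; apply: is_derive_continuous => y; exact: (is_derive_trigint s0 y bC bS).
Qed.

Let undamp_integrated (e a b : R) : 0 < e -> a <= b ->
  `|\int[leb]_(y in `[a, b]) trigint s (damp e (cosT h)) (damp e (sinT h)) y -
    \int[leb]_(y in `[a, b]) trigint s (cosT h) (sinT h) y| <=
  (e * s * N) *+ 2 * s * (b - a).
Proof.
move=> e0 ab.
have bC := bndfun_cosT s ih; have bS := bndfun_sinT s ih.
have dC := bndfun_damp e0 bC; have dS := bndfun_damp e0 bS.
have mT C S : bndfun s C N -> bndfun s S N -> measurable_fun setT (trigint s C S).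
  by move=> ? ?; apply: continuous_measurable_fun; exact: continuous_trigint.
have iT C S : bndfun s C N -> bndfun s S N -> leb.-integrable `[a, b] (EFin \o trigint s C S).
  move=> bC' bS'; apply: (@integrable_itv_bounded _ _ _ _ (N *+ 2 * s)).
    by apply: measurable_funTS; exact: mT.
  by move=> y _; exact: trigint_le.
rewrite -RintegralB//; [|exact: iT|exact: iT].
apply: Rintegral_itv_le => //; last by move=> y _; exact: undamp.
by apply: measurable_funTS; apply: measurable_funB; exact: mT.
Qed.

(** The two limits are [pi / 2] up to sign, and they differ, by pi, only when [x] lies between [a]
    and [b]. At the endpoints the kernel would tend to [pi / 2]; they form a null set and are left
    out. *)
Let cvg_atan_kernel (a b x : R) : a < b -> x != a -> x != b ->
  (h x * (atan ((b - x) / n.+1%:R^-1) - atan ((a - x) / n.+1%:R^-1))) @[n --> \oo]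
  --> h x * (pi * \1_(`[a, b]%classic : set R) x).
Proof.
move=> ab xa xb; apply: cvgM; first exact: cvg_cst.
rewrite indicE; have [xab|xab] := boolP (x \in _).
  move: xab; rewrite inE /= in_itv /= => /andP[ax xb'].
  have -> : (pi * true%:R = pi / 2 - - (pi / 2) :> R) by rewrite mulr1; field.
  apply: cvgB; first by apply: cvg_atan_scale; rewrite subr_gt0 lt_neqAle xb.
  by apply: cvg_atan_scaleN; rewrite subr_lt0 lt_neqAle eq_sym xa.
have [xa'|ax] := ltP x a.
  have -> : (pi * false%:R = pi / 2 - (pi / 2) :> R) by rewrite mulr0 subrr.
  apply: cvgB; apply: cvg_atan_scale; rewrite subr_gt0//.
  exact: lt_trans ab.
have bx : b < x.
  rewrite ltNge; apply/negP => xb'; move/negP: xab; apply.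
  by rewrite inE /= in_itv /= ax xb'.
have -> : (pi * false%:R = - (pi / 2) - - (pi / 2) :> R) by rewrite mulr0 subrr.
apply: cvgB; apply: cvg_atan_scaleN; rewrite subr_lt0//.
exact: lt_trans ab bx.
Qed.

(** The damped integral [U] with [e = 1 / (n + 1)] has two limits, one by [undamp_integrated], one
    by dominated convergence with bound [pi |h|]; they must agree. *)
Lemma trigint_inversion_itv (a b : R) : a < b ->
  \int[leb]_(y in `[a, b]) trigint s (cosT h) (sinT h) y =
  pi * \int[leb]_(y in `[a, b]) h y.
Proof.
move=> ab; have ab' := ltW ab.
have e0 n : 0 < n.+1%:R^-1 :> R by rewrite invr_gt0.
pose U n := \int[leb]_(y in `[a, b]) trigint s (damp n.+1%:R^-1 (cosT h)) (damp n.+1%:R^-1 (sinT h)) y.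
have U1 : U @ \oo --> \int[leb]_(y in `[a, b]) trigint s (cosT h) (sinT h) y.
  apply/cvgrPdist_le => e e0'; near=> n.
  rewrite distrC; apply: le_trans (undamp_integrated (e0 n) ab') _.
  have -> : n.+1%:R^-1 * s * N *+ 2 * s * (b - a) = (s * N *+ 2 * s * (b - a)) / n.+1%:R by ring.
  rewrite ler_pdivrMr// [e * _]mulrC -ler_pdivrMr//.
  apply: le_trans (_ : n%:R <= _); last by rewrite ler_nat.
  by near: n; exact: nbhs_infty_ger.
have m_atan (c : R) (e : R) : measurable_fun setT (fun x : R => atan ((c - x) / e)).
  apply: (measurableT_comp (continuous_measurable_fun (@continuous_atan R))).
  by apply: measurable_funM => //; exact: measurable_funB.
have U2 : U @ \oo --> \int[leb]_x (h x * (pi * \1_(`[a, b]%classic : set R) x)).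
  have -> : U = fun n => \int[leb]_x (h x * (atan ((b - x) / n.+1%:R^-1) - atan ((a - x) / n.+1%:R^-1))).
    by apply/funext => n; exact: abel_integrated.
  apply: (@dominated_cvg_Rintegral _ _ _ (fun x => pi * `|h x|)).
  - by move=> n; apply: measurable_funM; [exact: L1_measurable|exact: measurable_funB].
  - by apply: measurable_funM; [exact: L1_measurable|exact: measurable_funM].
  - exists [set a; b]; split; first by apply: measurableU; exact: measurable_set1.
      by apply: countable_lebesgue_measure0; apply: finite_set_countable; exact: finite_set2.
    move=> x /=; apply: contra_notP => /not_orP[/eqP xa /eqP xb].
    exact: cvg_atan_kernel.
  - exact/L1Z/L1_norm.
  - move=> n x; rewrite normrM mulrC ler_wpM2r// ler_norml.
    have A c := @atan_gtNpi2 R c; have B c := @atan_ltpi2 R c.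
    have := A ((b - x) / n.+1%:R^-1); have := B ((b - x) / n.+1%:R^-1).
    have := A ((a - x) / n.+1%:R^-1); have := B ((a - x) / n.+1%:R^-1).
    by move=> ? ? ? ?; apply/andP; split; lra.
have -> : \int[leb]_(y in `[a, b]) trigint s (cosT h) (sinT h) y =
   \int[leb]_x (h x * (pi * \1_(`[a, b]%classic : set R) x)).
  exact: (cvg_unique _ U1 U2).
rewrite -RintegralZl//; last exact: integrableS ih.
rewrite [RHS]Rintegral_mkcond; apply: eq_Rintegral => x _.
by rewrite patchE indicE; case: (x \in _); rewrite ?mulr1 ?mulr0// mulrC.
Unshelve. all: end_near. Qed.

End Abel.

(** Lebesgue differentiation: the integral of [D] from [- n] to [x] is 0 for all [x > - n], and its
    derivative is [D x] almost everywhere there. Finite base points are used because [D] is only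
    locally integrable; countably many of them exhaust the line. *)
Lemma Rintegral_itv0_ae (D : R -> R) : locally_integrable setT D ->
  (forall a b, a < b -> \int[leb]_(x in `[a, b]) D x = 0) ->
  {ae leb, forall x, D x = 0}.
Proof.
move=> lD D0; have [mD _ cD] := lD.
have iD (a b : R) : leb.-integrable `[a, b] (EFin \o D).
  apply/integrableP; split.
    by apply/measurable_EFinP; exact: measurable_funTS.
  by apply: cD => //; exact: segment_compact.
have ae_n (n : nat) : {ae leb, forall x, - n%:R < x -> D x = 0}.
  apply: aeS (FTC1 (iD (- n%:R)) lD) => x /= + nx.
  rewrite lte_fin nx => /(_ isT)[_ <-].
  rewrite derive1E -(@derive_cst _ _ R^o (0 : R) x 1).
  apply: near_eq_derive.
  near=> y; rewrite D0//; near: y.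
  exact: lt_nbhsr.
have := ae_foralln ae_n; apply: aeS => x H.
apply: (H (Num.trunc `|x|).+1).
rewrite ltrNl; apply: le_lt_trans (truncnS_gt _).
by rewrite -normrN ler_norm.
Unshelve. all: end_near. Qed.

(** For band-limited [h], the continuous representative of its class: bounds at every point hold for
    it, while [h] agrees with it only almost everywhere. *)
Definition bl_rep (s : R) h (y : R) : R := pi^-1 * trigint s (cosT h) (sinT h) y.

Section Representative.
Variables (s : R) (h : R -> R).
Hypotheses (s0 : 0 <= s) (bh : bandlimited s h).
Let N := \int[leb]_x `|h x|.
Let bC := bndfun_cosT s bh.1.
Let bS := bndfun_sinT s bh.1.

Lemma bl_rep_le y : `|bl_rep s h y| <= pi^-1 * (N *+ 2 * s).
Proof.
rewrite /bl_rep normrM gtr0_norm ?invr_gt0 ?pi_gt0//.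
by rewrite ler_wpM2l ?invr_ge0 ?pi_ge0// trigint_le.
Qed.

Lemma bl_rep_lipschitz x y :
  `|bl_rep s h x - bl_rep s h y| <= pi^-1 * ((s * N) *+ 2 * s) * `|x - y|.
Proof.
rewrite /bl_rep -mulrBr normrM gtr0_norm ?invr_gt0 ?pi_gt0// -mulrA.
rewrite ler_wpM2l ?invr_ge0 ?pi_ge0//.
apply: (is_derive_lipschitz (fun y => is_derive_trigint s0 y bC bS)).
exact: (trigint_le s0 (bndfunM bS) (bndfunN (bndfunM bC))).
Qed.

Lemma continuous_bl_rep : continuous (bl_rep s h).
Proof.
apply: is_derive_continuous => y; apply: is_deriveZ1.
exact: (is_derive_trigint s0 y bC bS).
Qed.

Lemma bl_rep_zeros : (exists x, bl_rep s h x <> 0) ->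
  {ae leb, forall x, bl_rep s h x <> 0}.
Proof.
move=> [x /eqP]; rewrite /bl_rep mulf_eq0 negb_or => /andP[p0 /eqP tx].
have := trigint_zeros_null s0 bC bS (ex_intro _ x tx); apply: aeS => y ty.
by apply/eqP; rewrite mulf_eq0 (negbTE p0); apply/eqP.
Qed.

Lemma bl_rep_ae : {ae leb, forall x, h x = bl_rep s h x}.
Proof.
have ih := bh.1.
have lh : locally_integrable setT h by apply: open_integrable_locally => //; exact: openT.
have lr : locally_integrable setT (bl_rep s h).
  split; [by apply: continuous_measurable_fun; exact: continuous_bl_rep|exact: openT|].
  move=> K _ cK.
  have /integrableP[] : leb.-integrable K (EFin \o bl_rep s h).
    apply: continuous_compact_integrable => //.
    exact/continuous_subspaceT/continuous_bl_rep.
  by [].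
have lD := locally_integrableB lh lr.
have H a b : a < b -> \int[leb]_(x in `[a, b]) ((h \- bl_rep s h)%R x) = 0.
  move=> ab; have ir : leb.-integrable `[a, b] (EFin \o trigint s (cosT h) (sinT h)).
    apply: continuous_compact_integrable; first exact: segment_compact.
    apply/continuous_subspaceT/is_derive_continuous => y.
    exact: (is_derive_trigint s0 y bC bS).
  have ir' : leb.-integrable `[a, b] (EFin \o bl_rep s h).
    apply: continuous_compact_integrable; first exact: segment_compact.
    exact/continuous_subspaceT/continuous_bl_rep.
  rewrite RintegralB//; last exact: integrableS ih.
  rewrite /bl_rep RintegralZl// (trigint_inversion_itv s0 bh ab).
  by rewrite mulKf ?subrr// gt_eqF// pi_gt0.
have := Rintegral_itv0_ae lD H; apply: aeS => x /= /eqP.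
by rewrite subr_eq0 => /eqP.
Qed.

End Representative.

End Inversion.

(** * Compactness: pointwise limits of bounded Lipschitz and band-limited sequences *)

Section Compactness.
Variable R : realType.
Local Notation leb := (@lebesgue_measure R).

(** The filter [within A U] is proper because every member of [U] meets [A], and it refines [U]; by
    maximality it equals [U]. This turns cluster points along [U] into limits. *)
Lemma ultra_meets (T : Type) (U : set_system T) (A : set T) : UltraFilter U ->
  (forall B, U B -> (B `&` A) !=set0) -> U A.
Proof.
move=> UU meet.
have WP : ProperFilter (within A U).
  split; last exact: within_filter.
  move=> W0; have [x [Bx Ax]] := meet _ W0; exact: (Bx Ax).
have <- : within A U = U.
  apply: max_filter => B UB; rewrite /within /=; apply: filterS UB => x Bx _; exact: Bx.
by rewrite /within /=; apply: filterE.
Qed.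

Section LipschitzSequence.
Variables (u : nat -> R -> R) (M L : R).
Hypothesis uM : forall n x, `|u n x| <= M.
Hypothesis uL : forall n x y, `|u n x - u n y| <= L * `|x - y|.

Let L0 : 0 <= L.
Proof. by have := le_trans (normr_ge0 _) (uL 0 1 0); rewrite subr0 normr1 mulr1. Qed.

Let ultra_limit (U : set_system nat) (x : R) : UltraFilter U ->
  exists p : R, forall e, 0 < e -> \forall n \near U, `|u n x - p| < e.
Proof.
move=> UU.
have [p [_ pc]] : (`[- M, M]%classic `&` cluster (u^~ x @ U)) !=set0.
  apply: (@segment_compact R (- M) M); apply: (@filterE _ U) => n.
  by rewrite /= in_itv /= -ler_norml.
exists p => e e0; apply: ultra_meets => B UB.
have [||_ [[n Bn <-] ne]] := pc (u^~ x @` B) (ball p e).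
- by apply: filterS UB => n Bn; exists n.
- exact: nbhsx_ballx.
by exists n; split => //; rewrite distrC; exact: ne.
Qed.

(* Pointwise limits along an ultrafilter exist by compactness; at stage k pick an
   index that is 1/(k+1)-close to the limit on a grid of mesh 1/(k+1). *)
Lemma lipschitz_subsequence : exists (g : R -> R) (phi : nat -> nat),
  (forall k, (k <= phi k)%N) /\ forall x, u (phi k) x @[k --> \oo] --> g x.
Proof.
have tri (a b c d A B : R) : `|a - b| <= A -> `|c - d| <= A -> `|b - d| < B ->
    `|c - a| <= A + A + B.
  rewrite ltr_norml !ler_norml.
  by move=> /andP[? ?] /andP[? ?] /andP[? ?]; apply/andP; split; lra.
have [U [UU sU]] := ultraFilterLemma eventually_filter.
have [g gP] := choice (fun x => ultra_limit x UU).
have gL x y : `|g x - g y| <= L * `|x - y|.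
  apply/ler_addgt0Pr => e e0; have e2 : 0 < e / 2 by rewrite divr_gt0.
  have [n [nx ny]] := @filter_ex _ U _ _ (filterI (gP x _ e2) (gP y _ e2)).
  have := uL n x y; move: nx ny; rewrite !ltr_norml !ler_norml.
  by move=> /andP[? ?] /andP[? ?] /andP[? ?]; apply/andP; split; lra.
(* For [j] from 0 to [2 (k + 1)^2] these points run from [- (k + 1)] to [k + 1] with mesh
   [1 / (k + 1)], so every [x] is eventually within one mesh of the grid. *)
pose pt (k : nat) (j : nat) : R := (j%:R - (k.+1 * k.+1)%:R) / k.+1%:R.
have sel k : exists n, (k <= n)%N /\
    forall j : 'I_((k.+1 * k.+1).*2.+1), `|u n (pt k j) - g (pt k j)| < k.+1%:R^-1.
  apply: (@filter_ex _ U); apply: filterI.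
    by apply: sU; exact: nbhs_infty_ge.
  by apply: filter_forall => j; apply: gP; rewrite invr_gt0.
have [phi phiP] := choice sel.
exists g, phi; split; first by move=> k; have [] := phiP k.
move=> x; apply/cvgrPdist_le => e e0; near=> k.
have k0 : 0 < k.+1%:R :> R by [].
have xk : `|x| <= k.+1%:R.
  apply: le_trans (_ : k%:R <= _); last by rewrite ler_nat.
  by near: k; exact: nbhs_infty_ger.
have xk0 : 0 <= (x + k.+1%:R) * k.+1%:R.
  by rewrite mulr_ge0//; move: xk; rewrite ler_norml => /andP[]; lra.
pose j := Num.trunc ((x + k.+1%:R) * k.+1%:R).
have /andP[j1 j2] : j%:R <= (x + k.+1%:R) * k.+1%:R < j.+1%:R by exact: truncn_itv.
have jlt : (j < (k.+1 * k.+1).*2.+1)%N.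
  rewrite ltnS -(ler_nat R); apply: le_trans j1 _.
  rewrite -muln2 !natrM -mulrA [_ * 2]mulrC mulrA ler_wpM2r ?ler0n//.
  by move: xk; rewrite ler_norml => /andP[]; lra.
have xpt : `|x - pt k j| <= k.+1%:R^-1.
  have -> : x - pt k j = ((x + k.+1%:R) * k.+1%:R - j%:R) / k.+1%:R.
    by rewrite /pt natrM; field.
  rewrite normrM [`|_^-1|]ger0_norm ?invr_ge0// -[leRHS]mul1r ler_wpM2r ?invr_ge0//.
  rewrite ger0_norm ?subr_ge0//; move: j2; rewrite -natr1; lra.
have H1 := (phiP k).2 (Ordinal jlt); rewrite /= in H1.
have H2 := uL (phi k) x (pt k j); have H3 := gL x (pt k j).
have H4 : L * `|x - pt k j| <= L * k.+1%:R^-1 by rewrite ler_wpM2l.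
apply: (@le_trans _ _ ((L *+ 2 + 1) * k.+1%:R^-1)).
  rewrite mulrDl mul1r mulrnAl mulr2n.
  exact: tri (le_trans H2 H4) (le_trans H3 H4) H1.
rewrite ler_pdivrMr// [e * _]mulrC -ler_pdivrMr//.
apply: le_trans (_ : k%:R <= _); last by rewrite ler_nat.
by near: k; exact: nbhs_infty_ger.
Unshelve. all: end_near. Qed.

End LipschitzSequence.

Lemma fatou_L1 (c_ : nat -> R -> R) (c : R -> R) (K : R) :
  (forall n x, 0 <= c_ n x) -> (forall n, L1 (c_ n)) ->
  (forall n, \int[leb]_x c_ n x <= K) -> (forall x, c_ ^~ x @ \oo --> c x) ->
  L1 c /\ \int[leb]_x c x <= K.
Proof.
move=> c0 ic cK cvg.
have mc : measurable_fun setT c.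
  apply: (measurable_fun_cvg (h := c_)) => [n|x _]; last exact: cvg.
  exact: L1_measurable.
have c0' x : 0 <= c x.
  rewrite -(cvg_lim _ (cvg x))//; apply: limr_ge; first by apply/cvg_ex; exists (c x).
  exact: nearW.
have F : (\int[leb]_x (c x)%:E <= K%:E)%E.
  have := @fatou _ _ R leb setT measurableT (fun n => EFin \o c_ n).
  have -> : (fun x => limn_einf (fun n => (EFin \o c_ n) x)) = (fun x => (c x)%:E).
    apply/funext => x; have cx : (EFin \o c_ n) x @[n --> \oo] --> (c x)%:E.
      by apply: cvg_comp (cvg x) _.
    rewrite is_cvg_limn_einfE; last by apply/cvg_ex; exists (c x)%:E.
    exact/cvg_lim.
  move=> H; apply: le_trans (H _ _) _.
  - by move=> n; apply/measurable_EFinP; exact: L1_measurable.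
  - by move=> n x _; rewrite lee_fin.
  rewrite limn_einf_lim; apply: lime_le; first exact: is_cvg_einfs.
  apply: nearW => n.
  apply: (@le_trans _ _ (\int[leb]_x (EFin \o c_ n) x)%E).
    by apply: ereal_inf_lbound; exists n => /=.
  rewrite -[X in (X <= _)%E]fineK; last exact: (integrable_fin_num measurableT (ic n)).
  by rewrite lee_fin; exact: cK.
have ic' : L1 c.
  apply/integrableP; split; first exact/measurable_EFinP.
  apply: le_lt_trans (ltry K); apply: le_trans F.
  by under eq_integral do rewrite /= ger0_norm//.
split => //; rewrite -lee_fin /Rintegral fineK//.
exact: (integrable_fin_num measurableT ic').
Qed.

(** [u] is cut at [X]: on [[- X, X]] dominated convergence applies with the constant [A M], and
    outside the small tail of [u] is paired with the uniform L1 bound [B]. The tail is taken below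
    [e / 2 / (B + 1)] so that [B = 0] is allowed. *)
Lemma weak_cvg0 (d : nat -> R -> R) (u : R -> R) (A B M : R) :
  (forall n, L1 (d n)) -> (forall n x, `|d n x| <= A) ->
  (forall n, \int[leb]_x `|d n x| <= B) -> (forall x, d ^~ x @ \oo --> (0 : R)) ->
  measurable_fun setT u -> (forall x, `|u x| <= M) ->
  (forall e, 0 < e -> exists X : R, forall x, X < `|x| -> `|u x| <= e) ->
  (\int[leb]_x (d n x * u x)) @[n --> \oo] --> (0 : R).
Proof.
move=> id dA dB d0 mu uM u0.
have A0 : 0 <= A by exact: le_trans (dA 0 0).
have M0 : 0 <= M by exact: le_trans (uM 0).
have B0 : 0 <= B by apply: le_trans (dB 0); apply: Rintegral_ge0.
apply/cvgrPdist_le => e e0.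
have e1 : 0 < e / 2 / (B + 1) by rewrite !divr_gt0// ltr_wpDl.
have [X uX] := u0 _ e1.
pose w x : R := u x * \1_(`[- X, X]%classic : set R) x.
have mw : measurable_fun setT w by apply: measurable_funM.
have wM x : `|w x| <= M.
  rewrite /w normrM -[leRHS]mulr1 ler_pM// indicE.
  by case: (_ \in _); rewrite ?normr1 ?normr0.
have uw x : `|u x - w x| <= e / 2 / (B + 1).
  rewrite /w indicE; have [xX|] := boolP (x \in _).
    by rewrite mulr1 subrr normr0 ltW.
  rewrite mulr0 subr0 => /negP xX; apply: uX; rewrite ltNge; apply/negP => h.
  by apply: xX; rewrite inE /= in_itv /= -ler_norml.
have wc : (\int[leb]_x (d n x * w x)) @[n --> \oo] --> (0 : R).
  have -> : (0 : R) = \int[leb]_x (cst 0 x) by rewrite Rintegral_cst// mul0r.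
  apply: (@dominated_cvg_Rintegral _ _ _ (fun x => (A * M) * \1_(`[- X, X]%classic : set R) x)) => //.
  - by move=> n; apply: measurable_funM => //; exact: L1_measurable.
  - apply: aeW => x; rewrite -(mul0r (w x)).
    by apply: cvgM; [exact: d0|exact: cvg_cst].
  - apply: L1Z; exact: integrable_indic_itv.
  - move=> n x; rewrite /w mulrA normrM [`|\1_ _ _|]ger0_norm; last first.
      by rewrite indicE; case: (_ \in _).
    by rewrite ler_wpM2r// normrM ler_pM.
have e2 : 0 < e / 2 by rewrite divr_gt0.
near=> n; rewrite sub0r normrN.
have -> : \int[leb]_x (d n x * u x) =
    \int[leb]_x (d n x * w x) + \int[leb]_x (d n x * (u x - w x)).
  rewrite -RintegralD//.
  - by apply: eq_Rintegral => x _; ring.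
  - exact: (L1_mulb (id n) mw wM).
  - by apply: (L1_mulb (id n) _ uw); exact: measurable_funB.
apply: le_trans (ler_normD _ _) _.
have -> : e = e / 2 + e / 2 by field.
apply: lerD.
  rewrite -normrN -sub0r; near: n.
  by move/cvgrPdist_le : wc => /(_ _ e2).
have mB : measurable_fun setT (fun x => u x - w x) by exact: measurable_funB.
apply: le_trans (Rintegral_mulb_le (id n) mB uw) _.
apply: (@le_trans _ _ (e / 2 / (B + 1) * (B + 1))).
  by rewrite ler_wpM2l ?(ltW e1)//; apply: le_trans (dB n) _; rewrite lerDl.
by rewrite mulfVK// gt_eqF// ltr_wpDl.
Unshelve. all: end_near. Qed.

Section CosineMeans.
Variables (t c d : R).
Hypothesis d0 : 0 < d.

(* Averaging cos (x r + c) over frequencies r in [t, t + d] produces a function of x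
   vanishing at infinity, against which the weak limit can be tested. *)
Definition cosmean (x : R) : R := d^-1 * \int[leb]_(r in `[t, t + d]) cos (x * r + c).

Let td : t <= t + d. Proof. by rewrite lerDl ltW. Qed.

Let mcos (x : R) : measurable_fun setT (fun r : R => cos (x * r + c)).
Proof. by under eq_fun do rewrite mulrC; exact: measurable_cos. Qed.

Let icos (x : R) : leb.-integrable `[t, t + d] (EFin \o fun r => cos (x * r + c)).
Proof.
apply: (@integrable_itv_bounded _ _ _ _ 1); first exact: measurable_funTS.
by move=> r _; exact: cos_max.
Qed.

Lemma cosmean_le x : `|cosmean x| <= 1.
Proof.
rewrite /cosmean normrM gtr0_norm ?invr_gt0// mulrC ler_pdivrMr//.
have := @Rintegral_itv_le _ (fun r => cos (x * r + c)) _ _ 1 td.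
rewrite [t + d]addrC addrK [d + t]addrC; apply; first exact: measurable_funTS.
by move=> r _; exact: cos_max.
Qed.

Lemma measurable_cosmean : measurable_fun setT cosmean.
Proof.
apply: measurable_funM => //; apply: continuous_measurable_fun => x.
apply: (@continuity_under_integral _ _ _ leb (fun x r => cos (x * r + c)) `[t, t + d]
  (measurable_itv _) (x - 1) (x + 1) _ _ (cst 1)).
- by move=> u _; exact: icos.
- by apply: aeW => r _ u _; exact: (is_derive_continuous (is_derive_cos_affine r c)).
- by apply: (@integrable_itv_bounded _ _ _ _ 1) => // r _; rewrite /= normr1.
- by move=> u _; apply: aeW => r _; exact: cos_max.
- by rewrite inE /= in_itv /= ltrBlDr ltrDl ltr01.
Qed.

(** An explicit Riemann-Lebesgue estimate: the primitive [sin (x r + c) / x] in [r] gives the bound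
    [2 / (d |x|)]. *)
Lemma cosmean_cvg0 e : 0 < e -> exists X : R, forall x, X < `|x| -> `|cosmean x| <= e.
Proof.
move=> e0; exists (2 / (d * e)) => x hx.
have x0 : 0 < `|x| by apply: le_lt_trans hx; rewrite divr_ge0// mulr_ge0// ltW.
have xn0 : x != 0 by rewrite -normr_gt0.
have dF (r : R) : is_derive r 1 (fun r => x^-1 * sin (r * x + c)) (cos (r * x + c)).
  have -> : cos (r * x + c) = x^-1 * (cos (r * x + c) * x) by rewrite mulrCA mulVf// mulr1.
  exact: (is_deriveZ1 _ (is_derive_sin_affine x c r)).
rewrite /cosmean.
under eq_Rintegral do rewrite mulrC.
rewrite (Rintegral_FTC td dF); last exact: (is_derive_continuous (is_derive_cos_affine x c)).
rewrite -mulrBr !normrM !normfV (gtr0_norm d0).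
apply: (@le_trans _ _ (d^-1 * (`|x|^-1 * 2))).
  rewrite ler_wpM2l ?invr_ge0 ?(ltW d0)// ler_wpM2l ?invr_ge0//.
  apply: le_trans (ler_normB _ _) _.
  by apply: le_trans (lerD (sin_max _) (sin_max _)) _.
rewrite ler_pdivrMl// ler_pdivrMl//.
by move: (ltW hx); rewrite ler_pdivrMr// mulr_gt0.
Qed.

Lemma cosmean_dist x : `|cosmean x - cos (x * t + c)| <= `|x| * d.
Proof.
have -> : cosmean x - cos (x * t + c) =
    d^-1 * \int[leb]_(r in `[t, t + d]) (cos (x * r + c) - cos (x * t + c)).
  rewrite RintegralB//; last first.
    by apply: (@integrable_itv_bounded _ _ _ _ 1) => // r _; exact: cos_max.
  rewrite Rintegral_cst//= lebesgue_measure_itv /= lte_fin ltrDl d0 /=.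
  by rewrite mulrBr; congr (_ - _); field; rewrite gt_eqF.
rewrite normrM gtr0_norm ?invr_gt0// mulrC ler_pdivrMr//.
have := @Rintegral_itv_le _ (fun r => cos (x * r + c) - cos (x * t + c)) _ _ (`|x| * d) td.
rewrite [t + d]addrC addrK [d + t]addrC; apply.
  by apply: measurable_funTS; exact: measurable_funB.
move=> r; rewrite in_itv /= => /andP[tr rd].
have := @is_derive_lipschitz _ (fun r => cos (r * x + c)) _ `|x|
  (is_derive_cos_affine x c) _ r t.
rewrite [r * x]mulrC [t * x]mulrC => H; apply: le_trans (H _) _.
  by move=> y; rewrite normrM normrN ler_piMl// sin_max.
by rewrite ler_wpM2l// ger0_norm ?subr_ge0//; lra.
Qed.

(** The averaging interval starts at [t] and extends to the right only, so every frequency involved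
    stays beyond the band. *)
Lemma Rintegral_cosmean h s : bandlimited s h -> s < t ->
  \int[leb]_x (h x * cosmean x) = 0.
Proof.
move=> [ih h0] st.
transitivity (d^-1 * \int[leb]_x (h x * \int[leb]_(r in `[t, t + d]) cos (x * r + c))).
  rewrite -RintegralZl//.
    by apply: eq_Rintegral => x _; rewrite /cosmean mulrCA.
  have := @L1_mulb _ h (fun x => d * cosmean x) d ih.
  have -> : (fun x => h x * (d * cosmean x)) = (fun x => h x * \int[leb]_(r in `[t, t + d]) cos (x * r + c)).
    by apply/funext => x; rewrite /cosmean mulVKf// gt_eqF.
  apply; first by apply: measurable_funM => //; exact: measurable_cosmean.
  by move=> x; rewrite normrM (gtr0_norm d0) ler_piMr ?cosmean_le// ltW.
rewrite (@Rintegral_fubini _ h (fun x r => cos (x * r + c)) t (t + d) 1 td ih).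
- transitivity (d^-1 * \int[leb]_(r in `[t, t + d]) (0 : R)).
    congr (_ * _); apply: eq_Rintegral => r; rewrite inE /= in_itv /= => /andP[tr _].
    by apply: h0; exact: lt_le_trans tr.
  by rewrite Rintegral_cst//= mul0r mulr0.
- apply: (measurableT_comp (continuous_measurable_fun (@continuous_cos R))).
  apply: measurable_funD => //.
  by apply: measurable_funM; [exact: measurable_fst|exact: measurable_snd].
- by move=> x r; exact: cos_max.
Qed.

End CosineMeans.

(** Two limits in a fixed order: for fixed [d] the integrals of [h n] against [cosmean] pass to the
    limit in n; then [d] tends to 0 by dominated convergence with bound [|g|], where only the
    integrability of [g] is used. Passing to the limit against the cosine itself would not be
    justified. *)
Lemma bandlimited_cvg (s A B : R) (h : nat -> R -> R) (g : R -> R) :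
  (forall n, bandlimited s (h n)) -> (forall n x, `|h n x| <= A) ->
  (forall n, \int[leb]_x `|h n x| <= B) -> L1 g ->
  (forall x, h ^~ x @ \oo --> g x) -> bandlimited s g.
Proof.
move=> bh hA hB ig hg; split => // t c st.
have ih n := (bh n).1.
have gA x : `|g x| <= A.
  have H : `|h n x| @[n --> \oo] --> `|g x| by apply: cvg_norm; exact: hg.
  rewrite -(cvg_lim _ H)//.
  by apply: limr_le; [apply/cvg_ex; eexists; exact: H|exact: nearW].
have dA n x : `|h n x - g x| <= A + A by apply: le_trans (ler_normB _ _) (lerD _ _).
have dB n : \int[leb]_x `|h n x - g x| <= B + \int[leb]_x `|g x|.
  apply: le_trans (lerD (hB n) (lexx _)).
  rewrite -RintegralD//; [|exact: L1_norm|exact: L1_norm].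
  apply: le_Rintegral => //; [exact/L1_norm/L1B|by apply: L1D; exact: L1_norm|].
  by move=> x _; exact: ler_normB.
have dc x : (h n x - g x) @[n --> \oo] --> (0 : R).
  by rewrite -(subrr (g x)); apply: cvgB; [exact: hg|exact: cvg_cst].
have zero (d : R) : 0 < d -> \int[leb]_x (g x * cosmean t c d x) = 0.
  move=> d0.
  have m := measurable_cosmean t c d; have b := cosmean_le t c d0.
  have := @weak_cvg0 (fun n x => h n x - g x) (cosmean t c d) _ _ 1
    (fun n => L1B (ih n) ig) dA dB dc m b (cosmean_cvg0 t c d0).
  have -> : (fun n => \int[leb]_x ((h n x - g x) * cosmean t c d x)) =
      cst (- \int[leb]_x (g x * cosmean t c d x)).
    apply/funext => n /=.
    under eq_Rintegral do rewrite mulrBl.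
    rewrite RintegralB//; [|exact: (L1_mulb (ih n) m b)|exact: (L1_mulb ig m b)].
    by rewrite (Rintegral_cosmean c d0 (bh n) st) sub0r.
  move=> H; apply: oppr_inj; rewrite oppr0.
  by have /(_ (@Rhausdorff R)) <- := cvg_lim _ H; rewrite lim_cst.
have e0 n : 0 < n.+1%:R^-1 :> R by rewrite invr_gt0.
have C : (\int[leb]_x (g x * cosmean t c n.+1%:R^-1 x)) @[n --> \oo] -->
    \int[leb]_x (g x * cos (x * t + c)).
  apply: (@dominated_cvg_Rintegral _ _ _ (fun x => `|g x|)).
  - by move=> n; apply: measurable_funM; [exact: L1_measurable|exact: measurable_cosmean].
  - by apply: measurable_funM; [exact: L1_measurable|exact: measurable_cos].
  - apply: aeW => x; apply: cvgM; first exact: cvg_cst.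
    apply/cvgrPdist_le => e ep; near=> n; rewrite distrC.
    apply: le_trans (cosmean_dist t c (e0 n) x) _.
    rewrite ler_pdivrMr// [e * _]mulrC -ler_pdivrMr//.
    apply: le_trans (_ : n%:R <= _); last by rewrite ler_nat.
    by near: n; exact: nbhs_infty_ger.
  - exact: L1_norm.
  - by move=> n x; rewrite normrM ler_piMr// cosmean_le.
have E : (fun n : nat => \int[leb]_x (g x * cosmean t c n.+1%:R^-1 x)) = cst 0.
  by apply/funext => n; exact: zero.
rewrite E in C.
by have /(_ (@Rhausdorff R)) <- := cvg_lim _ C; rewrite lim_cst.
Unshelve. all: end_near. Qed.

End Compactness.

(** * Complex values: modulus, L1 norm and reduction to real band-limited functions *)

Section Complex.
Variable R : realType.
Local Notation leb := (@lebesgue_measure R).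
Local Notation F := (R -> R[i]).
Implicit Types (z w : R[i]) (f g : F).

Lemma cReD z w : cRe (z + w) = cRe z + cRe w. Proof. by case: z w => [? ?] [? ?]. Qed.
Lemma cImD z w : cIm (z + w) = cIm z + cIm w. Proof. by case: z w => [? ?] [? ?]. Qed.
Lemma cReN z : cRe (- z) = - cRe z. Proof. by case: z. Qed.
Lemma cImN z : cIm (- z) = - cIm z. Proof. by case: z. Qed.
Lemma cReM z w : cRe (z * w) = cRe z * cRe w - cIm z * cIm w.
Proof. by case: z w => [? ?] [? ?]. Qed.
Lemma cImM z w : cIm (z * w) = cRe z * cIm w + cIm z * cRe w.
Proof. by case: z w => [? ?] [? ?]. Qed.

Lemma complex_ext z w : cRe z = cRe w -> cIm z = cIm w -> z = w.
Proof. by case: z w => [? ?] [? ?] /= -> ->. Qed.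

Lemma cnorm_ge0 z : 0 <= cnorm z. Proof. exact: sqrtr_ge0. Qed.

Lemma sqr_cnorm z : cnorm z ^+ 2 = cRe z ^+ 2 + cIm z ^+ 2.
Proof. by rewrite sqr_sqrtr// addr_ge0 ?sqr_ge0. Qed.

Lemma cnorm_real (k : R) : cnorm (Complex k 0) = `|k|.
Proof. by rewrite /cnorm /= expr0n /= addr0 sqrtr_sqr. Qed.

Lemma cnorm0 : cnorm (0 : R[i]) = 0. Proof. by rewrite cnorm_real normr0. Qed.

Lemma cnorm1 : cnorm (1 : R[i]) = 1. Proof. by rewrite cnorm_real normr1. Qed.

Lemma cnorm_eq0 z : cnorm z = 0 -> z = 0.
Proof.
move=> z0; have := sqr_cnorm z; rewrite z0 expr0n /= => /esym/eqP.
rewrite paddr_eq0 ?sqr_ge0// !sqrf_eq0 => /andP[/eqP zr /eqP zi].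
by apply: complex_ext.
Qed.

Lemma cnormM z w : cnorm (z * w) = cnorm z * cnorm w.
Proof.
apply: (@pexpIrn _ 2) => //; rewrite ?nnegrE ?mulr_ge0 ?cnorm_ge0//.
by rewrite exprMn !sqr_cnorm cReM cImM; ring.
Qed.

Lemma cnormN z : cnorm (- z) = cnorm z.
Proof. by rewrite /cnorm cReN cImN !sqrrN. Qed.

Lemma cnormD z w : cnorm (z + w) <= cnorm z + cnorm w.
Proof.
rewrite -ler_sqr ?nnegrE ?addr_ge0 ?cnorm_ge0//.
rewrite sqrrD !sqr_cnorm cReD cImD.
(* Cauchy-Schwarz in the plane, from Lagrange's identity: the defect of the squares is
   [(cRe z * cIm w - cIm z * cRe w)^2]. *)
suff : cRe z * cRe w + cIm z * cIm w <= cnorm z * cnorm w by lra.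
rewrite -cnormM; apply: le_trans (ler_norm _) _.
rewrite -ler_sqr ?nnegrE ?cnorm_ge0// sqr_cnorm cReM cImM real_normK ?num_real//.
have := sqr_ge0 (cRe z * cIm w - cIm z * cRe w); lra.
Qed.

Lemma cnormB z w : cnorm (z - w) <= cnorm z + cnorm w.
Proof. by rewrite -(cnormN w); exact: cnormD. Qed.

Lemma cRe_le z : `|cRe z| <= cnorm z.
Proof.
rewrite -ler_sqr ?nnegrE ?cnorm_ge0// sqr_cnorm real_normK ?num_real//.
by rewrite lerDl sqr_ge0.
Qed.

Lemma cIm_le z : `|cIm z| <= cnorm z.
Proof.
rewrite -ler_sqr ?nnegrE ?cnorm_ge0// sqr_cnorm real_normK ?num_real//.
by rewrite lerDr sqr_ge0.
Qed.

Lemma cnorm_le z : cnorm z <= `|cRe z| + `|cIm z|.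
Proof.
rewrite -ler_sqr ?nnegrE ?cnorm_ge0 ?addr_ge0// sqr_cnorm sqrrD !real_normK ?num_real//.
by rewrite lerD2r lerDl mulrn_wge0// mulr_ge0.
Qed.

Lemma cvg_cnorm (z_ : nat -> R[i]) z :
  (cRe (z_ n)) @[n --> \oo] --> cRe z -> (cIm (z_ n)) @[n --> \oo] --> cIm z ->
  cnorm (z_ n) @[n --> \oo] --> cnorm z.
Proof.
move=> cr ci.
have c2 : (cRe (z_ n) ^+ 2 + cIm (z_ n) ^+ 2) @[n --> \oo] --> cRe z ^+ 2 + cIm z ^+ 2.
  by apply: cvgD; rewrite !expr2; apply: cvgM.
exact: (cvg_comp _ _ c2 (@sqrt_continuous R _)).
Qed.

Lemma measurable_cnorm f : measurable_fun setT (fun x => cRe (f x)) ->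
  measurable_fun setT (fun x => cIm (f x)) ->
  measurable_fun setT (fun x => cnorm (f x)).
Proof.
move=> mr mi; apply: (measurableT_comp (continuous_measurable_fun (@sqrt_continuous R))).
by apply: measurable_funD; exact: measurable_funX.
Qed.

Lemma L1_cRe f : cintegrable f -> L1 (fun x => cRe (f x)). Proof. by case. Qed.
Lemma L1_cIm f : cintegrable f -> L1 (fun x => cIm (f x)). Proof. by case. Qed.

Lemma L1_cnorm f : cintegrable f -> L1 (fun x => cnorm (f x)).
Proof.
move=> [ir ii]; apply: (@L1_le _ _ (fun x => `|cRe (f x)| + `|cIm (f x)|)).
- by apply: measurable_cnorm; exact: L1_measurable.
- by move=> x; rewrite ger0_norm ?cnorm_ge0 ?cnorm_le.
- by apply: L1D; exact: L1_norm.
Qed.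

Lemma cintegrable_lin (a : R[i]) f g : cintegrable f -> cintegrable g ->
  cintegrable (fun x => a * f x + g x).
Proof.
move=> [fr fi] [gr gi]; split.
- have -> : (fun x => (cRe (a * f x + g x))%:E) =
      EFin \o (fun x => (cRe a * cRe (f x) - cIm a * cIm (f x)) + cRe (g x)).
    by apply/funext => x /=; rewrite cReD cReM.
  by apply: L1D => //; apply: L1B; exact: L1Z.
- have -> : (fun x => (cIm (a * f x + g x))%:E) =
      EFin \o (fun x => (cRe a * cIm (f x) + cIm a * cRe (f x)) + cIm (g x)).
    by apply/funext => x /=; rewrite cImD cImM.
  by apply: L1D => //; apply: L1D; exact: L1Z.
Qed.

Lemma L1_0 : L1 (fun _ : R => 0 : R).
Proof. by apply: eq_integrable (integrable0 leb setT) => //. Qed.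

Lemma cintegrable0 : cintegrable (fun _ : R => 0 : R[i]).
Proof. by split; exact: L1_0. Qed.

Lemma cintegrableB f g : cintegrable f -> cintegrable g ->
  cintegrable (fun x => f x - g x).
Proof.
move=> fi gi; have := cintegrable_lin (-1) gi fi.
by congr cintegrable; apply/funext => x; rewrite mulN1r addrC.
Qed.

Lemma L1norm_ge0 f : 0 <= L1norm f.
Proof. by apply: Rintegral_ge0 => x _; exact: cnorm_ge0. Qed.

Lemma L1normZ (a : R[i]) f : cintegrable f ->
  L1norm (fun x => a * f x) = cnorm a * L1norm f.
Proof.
move=> fi; rewrite /L1norm -RintegralZl//; last exact: L1_cnorm.
by apply: eq_Rintegral => x _; rewrite cnormM.
Qed.

Lemma Rintegral_ae (h1 h2 : R -> R) : L1 h1 -> L1 h2 ->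
  {ae leb, forall x, h1 x = h2 x} -> \int[leb]_x h1 x = \int[leb]_x h2 x.
Proof.
move=> i1 i2 e; rewrite /Rintegral; congr fine; apply: ae_eq_integral => //.
- exact: (measurable_int leb i1).
- exact: (measurable_int leb i2).
- by apply: aeS e => x -> _.
Qed.

Lemma L1_ae (h1 h2 : R -> R) : L1 h1 -> measurable_fun setT h2 ->
  {ae leb, forall x, h1 x = h2 x} -> L1 h2.
Proof.
move=> i1 m2 e; apply/integrableP; split; first exact/measurable_EFinP.
have /integrableP[m1] := i1; congr (_ < _)%E.
apply: ae_eq_integral => //.
- exact: measurableT_comp.
- by apply: measurableT_comp => //; exact/measurable_EFinP.
- by apply: aeS e => x /= -> _.
Qed.

Lemma L1norm_ae f g : cintegrable f -> cintegrable g -> L1eq f g ->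
  L1norm f = L1norm g.
Proof.
move=> fi gi e; apply: Rintegral_ae; [exact: L1_cnorm|exact: L1_cnorm|].
by apply: aeS e => x ->.
Qed.

Lemma L1norm_eq0_sub f g : cintegrable f -> cintegrable g -> L1eq f g ->
  L1norm (fun x => f x - g x) = 0.
Proof.
move=> fi gi e.
rewrite (@L1norm_ae _ (fun _ => 0)) //.
- by rewrite /L1norm cnorm0 Rintegral_cst// mul0r.
- exact: cintegrableB.
- exact: cintegrable0.
- by apply: aeS e => x ->; rewrite subrr.
Qed.

Lemma cosTN (h : R -> R) (t : R) : cosT h (- t) = cosT h t.
Proof. by apply: eq_Rintegral => x _; rewrite mulrN cosN. Qed.

Lemma sinTN (h : R -> R) (t : R) : L1 h -> sinT h (- t) = - sinT h t.
Proof.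
move=> ih; rewrite -[RHS]mulN1r /sinT -RintegralZl//.
  by apply: eq_Rintegral => x _; rewrite mulrN sinN; ring.
exact: L1_sinM.
Qed.

Lemma bandlimitedP (s : R) (h : R -> R) : L1 h ->
  bandlimited s h <-> forall t, s < t -> cosT h t = 0 /\ sinT h t = 0.
Proof.
move=> ih; split=> [[_ bh] t st|H].
  split.
    by rewrite -(bh t 0 st); apply: eq_Rintegral => x _; rewrite addr0.
  rewrite -(bh t (- (pi / 2)) st); apply: eq_Rintegral => x _.
  by rewrite cosB cos_pihalf sin_pihalf mulr0 add0r mulr1.
split => // t c st; have [H1 H2] := H t st.
have ic := L1_cosM t ih; have is_ := L1_sinM t ih.
have -> : \int[leb]_x (h x * cos (x * t + c)) =
  \int[leb]_x (h x * cos (x * t) * cos c - h x * sin (x * t) * sin c).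
  by apply: eq_Rintegral => x _; rewrite cosD; ring.
rewrite RintegralB//; first last.
- by apply: (@L1_mulb _ _ (cst (sin c)) 1) => // x; exact: sin_max.
- by apply: (@L1_mulb _ _ (cst (cos c)) 1) => // x; exact: cos_max.
by rewrite !RintegralZr// -/(cosT h t) -/(sinT h t) H1 H2 !mul0r subrr.
Qed.

Lemma fourierE f (t : R) : cintegrable f ->
  fourier f t = Complex (cosT (fun x => cRe (f x)) t + sinT (fun x => cIm (f x)) t)
                        (cosT (fun x => cIm (f x)) t - sinT (fun x => cRe (f x)) t).
Proof.
move=> [fr fi].
have ic h := @L1_cosM R h t; have is_ h := @L1_sinM R h t.
rewrite /fourier /cint /cosT /sinT; congr Complex.
- rewrite -RintegralD//; [|exact: ic|exact: is_].
  by apply: eq_Rintegral => x _; rewrite cReM /expi /cRe /cIm /= cosN sinN; ring.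
- rewrite -RintegralB//; [|exact: ic|exact: is_].
  by apply: eq_Rintegral => x _; rewrite cImM /expi /cRe /cIm /= cosN sinN; ring.
Qed.

(** Cosine transforms are even and sine transforms odd in [t], so the equations at [t] and [- t]
    form a linear system that forces all four real transforms to vanish separately. *)
Lemma inBP (s : R) f : 0 <= s -> inB s f <->
  bandlimited s (fun x => cRe (f x)) /\ bandlimited s (fun x => cIm (f x)).
Proof.
move=> s0; split=> [[fi f0]|[br bi]].
  have [ir ii] := fi.
  suff H t : s < t -> [/\ cosT (fun x => cRe (f x)) t = 0, sinT (fun x => cRe (f x)) t = 0,
      cosT (fun x => cIm (f x)) t = 0 & sinT (fun x => cIm (f x)) t = 0].
    by split; apply/bandlimitedP => // t /H[].
  move=> st; have t0 : 0 < t by exact: le_lt_trans st.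
  have := f0 t; have := f0 (- t); rewrite normrN gtr0_norm// => /(_ st) + /(_ st).
  rewrite !fourierE// !cosTN !sinTN// => -[e1 e2] [e3 e4].
  by split; lra.
have fi : cintegrable f by split; [exact: br.1|exact: bi.1].
split => // t st; rewrite fourierE//.
have z (h : R -> R) : bandlimited s h -> cosT h t = 0 /\ sinT h t = 0.
  move=> bh; have /bandlimitedP H := bh.1; have {}H := (H s).1 bh.
  have [t0|t0] := leP 0 t; first by apply: H; rewrite ger0_norm in st.
  have [] := H (- t); first by rewrite ltr0_norm in st.
  rewrite cosTN sinTN; last exact: bh.1.
  by move=> -> /eqP; rewrite oppr_eq0 => /eqP ->.
have [-> ->] := z _ br; have [-> ->] := z _ bi.
by rewrite addr0 subrr.
Qed.

Lemma inB_cintegrable (s : R) f : inB s f -> cintegrable f. Proof. by case. Qed.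

Lemma inB_lin (s : R) (a : R[i]) f g : inB s f -> inB s g ->
  inB s (fun x => a * f x + g x).
Proof.
move=> [fi f0] [gi g0]; split; first exact: cintegrable_lin.
move=> t st; rewrite fourierE; last exact: cintegrable_lin.
have := f0 t st; have := g0 t st; rewrite !fourierE// => -[g1 g2] [f1 f2].
have ic h := @L1_cosM R h t; have is_ h := @L1_sinM R h t.
have lc (k l : R) (p q r : R -> R) : L1 p -> L1 q -> L1 r ->
    cosT (fun x => k * p x + l * q x + r x) t = k * cosT p t + l * cosT q t + cosT r t.
  move=> ip iq ir; rewrite /cosT -!RintegralZl//; try exact: ic.
  rewrite -RintegralD//; try by apply: L1Z; exact: ic.
  rewrite -RintegralD//; [|by apply: L1D; apply: L1Z; exact: ic|exact: ic].
  by apply: eq_Rintegral => x _; ring.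
have ls (k l : R) (p q r : R -> R) : L1 p -> L1 q -> L1 r ->
    sinT (fun x => k * p x + l * q x + r x) t = k * sinT p t + l * sinT q t + sinT r t.
  move=> ip iq ir; rewrite /sinT -!RintegralZl//; try exact: is_.
  rewrite -RintegralD//; try by apply: L1Z; exact: is_.
  rewrite -RintegralD//; [|by apply: L1D; apply: L1Z; exact: is_|exact: is_].
  by apply: eq_Rintegral => x _; ring.
have [fr fm] := fi; have [gr gm] := gi.
have -> : (fun x => cRe (a * f x + g x)) =
    (fun x => cRe a * cRe (f x) + (- cIm a) * cIm (f x) + cRe (g x)).
  by apply/funext => x; rewrite cReD cReM mulNr.
have -> : (fun x => cIm (a * f x + g x)) =
    (fun x => cRe a * cIm (f x) + cIm a * cRe (f x) + cIm (g x)).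
  by apply/funext => x; rewrite cImD cImM.
rewrite !lc// !ls//; move: f1 f2 g1 g2.
move: (cosT (fun x => cRe (f x)) t) (sinT (fun x => cRe (f x)) t) => fc fs.
move: (cosT (fun x => cIm (f x)) t) (sinT (fun x => cIm (f x)) t) => fc' fs'.
move: (cosT (fun x => cRe (g x)) t) (sinT (fun x => cRe (g x)) t) => gc gs.
move: (cosT (fun x => cIm (g x)) t) (sinT (fun x => cIm (g x)) t) => gc' gs'.
move=> f1 f2 g1 g2; congr Complex.
- transitivity (cRe a * (fc + fs') - cIm a * (fc' - fs) + (gc + gs')); first by ring.
  by rewrite f1 f2 g1 !mulr0 subrr addr0.
- transitivity (cRe a * (fc' - fs) + cIm a * (fc + fs') + (gc' - gs)); first by ring.
  by rewrite f1 f2 g2 !mulr0 !addr0.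
Qed.

Lemma inB0 (s : R) : inB s (fun _ => 0 : R[i]).
Proof.
split; first exact: cintegrable0.
move=> t _; rewrite fourierE; last exact: cintegrable0.
have z (g : R -> R) : \int[leb]_x ((0 : R) * g x) = 0.
  by under eq_Rintegral do rewrite mul0r; rewrite Rintegral_cst// mul0r.
by rewrite /cosT /sinT /= !z addr0 subrr.
Qed.

Lemma inBZ (s : R) (a : R[i]) f : inB s f -> inB s (fun x => a * f x).
Proof.
move=> fB; have := inB_lin a fB (inB0 s).
by congr inB; apply/funext => x; rewrite addr0.
Qed.

Lemma inBB (s : R) f g : inB s f -> inB s g -> inB s (fun x => f x - g x).
Proof.
move=> fB gB; have := inB_lin (-1) gB fB.
by congr inB; apply/funext => x; rewrite mulN1r addrC.
Qed.

End Complex.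

(** * Contractive functionals and uniqueness of the exposing one *)

Section Functionals.
Variables (R : realType) (s : R).
Local Notation leb := (@lebesgue_measure R).
Local Notation F := (R -> R[i]).
Implicit Types (f g : F) (Phi Psi : F -> R[i]).

Definition contractive Phi : Prop := forall g, inB s g -> cnorm (Phi g) <= L1norm g.

Lemma linear_on_B0 Phi : linear_on_B s Phi -> Phi (fun _ => 0) = 0.
Proof.
move=> lin; have := lin 1 _ _ (inB0 s) (inB0 s).
have -> : (fun x : R => 1 * (0 : R[i]) + 0) = (fun _ => 0).
  by apply/funext => x; rewrite mulr0 addr0.
by rewrite mul1r => /eqP; rewrite -subr_eq0 opprD addrA subrr sub0r oppr_eq0 => /eqP.
Qed.

Lemma linear_on_BZ Phi (a : R[i]) f : linear_on_B s Phi -> inB s f ->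
  Phi (fun x => a * f x) = a * Phi f.
Proof.
move=> lin fB; have := lin a _ _ fB (inB0 s); rewrite linear_on_B0// addr0 => <-.
by congr Phi; apply/funext => x; rewrite addr0.
Qed.

Lemma linear_on_BB Phi f g : linear_on_B s Phi -> inB s f -> inB s g ->
  Phi (fun x => f x - g x) = Phi f - Phi g.
Proof.
move=> lin fB gB; have := lin (-1) _ _ gB fB; rewrite mulN1r addrC => <-.
by congr Phi; apply/funext => x; rewrite mulN1r addrC.
Qed.

(** The set under the [sup] of [opnorm] is first bounded above: continuity at 0 and homogeneity give
    [2 / d] on the unit ball. Only then does [opnorm] equal to 1 yield an inequality for each
    [g]. *)
Lemma exposing_contractive f Phi : exposing s f Phi -> contractive Phi.
Proof.
move=> [[lin cont] [_ [op1 _]]] g gB.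
have [d [d0 dP]] := cont _ (inB0 s) 1 ltr01.
have bd : has_sup [set r | exists2 g, inD s g & r = cnorm (Phi g)].
  split; first by exists (cnorm (Phi (fun _ => 0))), (fun _ => 0) => //; split;
    [exact: inB0|rewrite /L1norm cnorm0 Rintegral_cst// mul0r ler01].
  exists (2 / d) => _ [h [hB h1] ->].
  have hi := inB_cintegrable hB.
  have dd : cnorm (Complex (d / 2) 0 : R[i]) = d / 2.
    by rewrite cnorm_real ger0_norm// divr_ge0// ltW.
  have := dP (fun x => Complex (d / 2) 0 * h x) (inBZ _ hB).
  have -> : (fun x => Complex (d / 2) 0 * h x - 0) = (fun x => Complex (d / 2) 0 * h x).
    by apply/funext => x; rewrite subr0.
  rewrite L1normZ// dd linear_on_BZ// linear_on_B0// subr0 cnormM dd => H.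
  rewrite ler_pdivlMr//; have : d / 2 * cnorm (Phi h) < 1.
    apply: H; apply: (@le_lt_trans _ _ (d / 2 * 1)).
      by rewrite ler_wpM2l// divr_ge0// ltW.
    by rewrite mulr1 ltr_pdivrMr// ltr_pMr// ltr1n.
  by move=> /ltW; rewrite mulrAC ler_pdivrMr// mul1r mulrC.
have gi := inB_cintegrable gB.
(* The extra [e] makes the normalisation [g / c] possible even when [L1norm g] is 0. *)
apply/ler_addgt0Pr => e e0; set c := L1norm g + e.
have c0 : 0 < c by rewrite ltr_wpDl ?L1norm_ge0.
have cc : cnorm (Complex c^-1 0 : R[i]) = c^-1.
  by rewrite cnorm_real ger0_norm// invr_ge0 ltW.
have : cnorm (Phi (fun x => Complex c^-1 0 * g x)) <= 1.
  rewrite -op1; apply: ub_le_sup; first exact: bd.2.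
  exists (fun x => Complex c^-1 0 * g x) => //; split; first exact: inBZ.
  by rewrite L1normZ// cc ler_pdivrMl// mulr1 lerDl ltW.
by rewrite linear_on_BZ// cnormM cc ler_pdivrMl// mulr1.
Qed.

(** The parallelogram law bounds the square of [|z + w| + |z - w|] by [4 (|z|^2 + |w|^2)], which is
    the square of [2 |z| + |w|^2 / |z|] without its last term. *)
Lemma cnorm_second_difference (z w : R[i]) : z != 0 ->
  cnorm (z + w) + cnorm (z - w) - cnorm z *+ 2 <= cnorm w ^+ 2 / cnorm z.
Proof.
move=> z0; have nz : 0 < cnorm z.
  rewrite lt_neqAle cnorm_ge0 andbT eq_sym; apply/eqP => /cnorm_eq0 /eqP.
  by rewrite (negbTE z0).
have nw := cnorm_ge0 w; have np := cnorm_ge0 (z + w); have nm := cnorm_ge0 (z - w).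
rewrite lerBlDr -ler_sqr ?nnegrE ?addr_ge0 ?mulrn_wge0 ?divr_ge0 ?sqr_ge0 ?cnorm_ge0//.
apply: (@le_trans _ _ ((cnorm z ^+ 2 + cnorm w ^+ 2) *+ 4)).
  have : cnorm (z + w) ^+ 2 + cnorm (z - w) ^+ 2 = (cnorm z ^+ 2 + cnorm w ^+ 2) *+ 2.
    by rewrite !sqr_cnorm !cReD !cImD cReN cImN; ring.
  have := sqr_ge0 (cnorm (z + w) - cnorm (z - w)).
  rewrite sqrrB sqrrD; lra.
rewrite sqrrD mulrnAr mulfVK ?gt_eqF//.
have := sqr_ge0 (cnorm w ^+ 2 / cnorm z); lra.
Qed.

(* |f + t g| + |f - t g| - 2 |f| = O(t^2) wherever f <> 0, so that the norm is
   Gateaux differentiable at f. *)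
Lemma cRe_functional_le Phi Psi f g : linear_on_B s Phi -> linear_on_B s Psi ->
  contractive Phi -> contractive Psi -> inD s f -> Phi f = 1 -> Psi f = 1 ->
  {ae leb, forall x, f x != 0} -> inB s g -> cRe (Phi g) <= cRe (Psi g).
Proof.
move=> lPhi lPsi cPhi cPsi [fB f1] Phif Psif fn0 gB.
have fi := inB_cintegrable fB; have gi := inB_cintegrable gB.
have L1f : L1norm f = 1.
  by apply/eqP; rewrite eq_le f1 -cnorm1 -Phif cPhi.
pose t n : R := n.+1%:R^-1.
have t0 n : 0 < t n by rewrite invr_gt0.
pose fp n x := Complex (t n) 0 * g x + f x.
pose fm n x := Complex (- t n) 0 * g x + f x.
have fpB n : inB s (fp n) by exact: inB_lin.
have fmB n : inB s (fm n) by exact: inB_lin.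
have ip n := L1_cnorm (inB_cintegrable (fpB n)).
have im n := L1_cnorm (inB_cintegrable (fmB n)).
have if_ := L1_cnorm fi; have ig := L1_cnorm gi.
pose k n x := n.+1%:R * (cnorm (fp n x) + cnorm (fm n x) - cnorm (f x) *+ 2).
have ik n : L1 (k n).
  apply: L1Z; apply: L1B; first exact: L1D.
  by under eq_fun do rewrite mulr2n; exact: L1D.
(* [Phi] is tested on [f + t g] and [Psi] on [f - t g]. As both take at [f] the value 1, the norm of
   [f], adding the two inequalities leaves [t (Re Phi g - Re Psi g)] below the second difference of
   the norm. *)
have ub n : cRe (Phi g) - cRe (Psi g) <= \int[leb]_x k n x.
  rewrite /k RintegralZl//; last first.
    apply: L1B; first exact: L1D.
    by under eq_fun do rewrite mulr2n; exact: L1D.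
  rewrite RintegralB//; [|exact: L1D|by under eq_fun do rewrite mulr2n; exact: L1D].
  rewrite (RintegralD measurableT (ip n) (im n)).
  under [X in _ <= _ * (_ - X)]eq_Rintegral do rewrite mulr2n.
  rewrite (RintegralD measurableT if_ if_) -/(L1norm (fp n)) -/(L1norm (fm n)) -/(L1norm f) L1f.
  have H1 := le_trans (ler_norm _) (le_trans (cRe_le _) (cPhi _ (fpB n))).
  have H2 := le_trans (ler_norm _) (le_trans (cRe_le _) (cPsi _ (fmB n))).
  move: H1 H2; rewrite /fp /fm lPhi// lPsi// Phif Psif !cReD !cReM /=.
  rewrite !mul0r !subr0 -/(fp n) -/(fm n) => H1 H2.
  rewrite -ler_pdivrMl// -/(t n) mulrBr.
  by move: (t n) H1 H2 => tn; rewrite /cRe /=; lra.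
have kc : (\int[leb]_x k n x) @[n --> \oo] --> (0 : R).
  have -> : (0 : R) = \int[leb]_x (cst 0 x) by rewrite Rintegral_cst// mul0r.
  have cw n x : cnorm (Complex (t n) 0 * g x) = t n * cnorm (g x).
    by rewrite cnormM cnorm_real gtr0_norm.
  have fmE n x : fm n x = f x - Complex (t n) 0 * g x.
    rewrite /fm addrC; congr (_ + _); apply: complex_ext;
      by rewrite ?cReN ?cImN ?cReM ?cImM /cRe /cIm /=; ring.
  have k0 n x : 0 <= k n x.
    rewrite mulr_ge0// subr_ge0.
    have -> : cnorm (f x) *+ 2 = cnorm (fp n x + fm n x).
      have -> : fp n x + fm n x = Complex 2 0 * f x.
        rewrite fmE /fp; apply: complex_ext;
          by rewrite ?(cReD, cReN, cReM, cImD, cImN, cImM) /cRe /cIm /=; ring.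
      by rewrite cnormM cnorm_real ger0_norm// mulr_natl.
    exact: cnormD.
  (* The triangle inequality bounds [k n] by [2 |g|] everywhere; the pointwise limit 0 is where
     [f x != 0] is used. *)
  apply: (@dominated_cvg_Rintegral _ _ _ (fun x => cnorm (g x) *+ 2)) => //.
  - by move=> n; exact: L1_measurable.
  - apply: aeS fn0 => x fx0; apply/cvgrPdist_le => e e0; near=> n.
    rewrite sub0r normrN ger0_norm//.
    apply: (@le_trans _ _ (n.+1%:R * ((t n * cnorm (g x)) ^+ 2 / cnorm (f x)))).
      rewrite /k ler_wpM2l// -cw fmE /fp [_ + f x]addrC.
      exact: cnorm_second_difference.
    have -> : n.+1%:R * ((t n * cnorm (g x)) ^+ 2 / cnorm (f x)) =
      cnorm (g x) ^+ 2 / cnorm (f x) / n.+1%:R.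
      rewrite exprMn /t expr2 !mulrA mulfV ?mul1r ?pnatr_eq0//.
      by ring.
    rewrite ler_pdivrMr// [e * _]mulrC -ler_pdivrMr//.
    apply: le_trans (_ : n%:R <= _); last by rewrite ler_nat.
    by near: n; exact: nbhs_infty_ger.
  - by under eq_fun do rewrite mulr2n; exact: L1D.
  - move=> n x; rewrite ger0_norm// /k.
    have H1 : cnorm (fp n x) <= t n * cnorm (g x) + cnorm (f x).
      by rewrite -cw; exact: cnormD.
    have H2 : cnorm (fm n x) <= cnorm (f x) + t n * cnorm (g x).
      by rewrite fmE -cw; exact: cnormB.
    have -> : cnorm (g x) *+ 2 = n.+1%:R * ((t n * cnorm (g x)) *+ 2).
      by rewrite mulrnAr mulrA mulfV ?mul1r ?pnatr_eq0.
    rewrite ler_wpM2l//; lra.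
rewrite -subr_le0; have /(_ (@Rhausdorff R)) <- := cvg_lim _ kc.
by apply: limr_ge; [apply/cvg_ex; eexists; exact: kc|exact: nearW].
Unshelve. all: end_near. Qed.

(** Exchanging [Phi] and [Psi] gives equality of real parts; imaginary parts follow by testing with
    [i g]. *)
Lemma functional_unique Phi Psi f g : linear_on_B s Phi -> linear_on_B s Psi ->
  contractive Phi -> contractive Psi -> inD s f -> Phi f = 1 -> Psi f = 1 ->
  {ae leb, forall x, f x != 0} -> inB s g -> Phi g = Psi g.
Proof.
move=> lPhi lPsi cPhi cPsi fD Phif Psif fn0 gB.
have re g' : inB s g' -> cRe (Phi g') = cRe (Psi g').
  by move=> g'B; apply/eqP; rewrite eq_le !(@cRe_functional_le _ _ f).
apply: complex_ext; first exact: re.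
have := re _ (inBZ (Complex 0 1) gB); rewrite !linear_on_BZ// !cReM.
by rewrite /cRe /cIm /= !mul0r !mul1r !sub0r => /oppr_inj.
Qed.

End Functionals.

(** * From weak* exposed to strongly exposed points *)

Section StrongExposedness.
Variables (R : realType) (s : R).
Hypothesis s0 : 0 <= s.
Local Notation leb := (@lebesgue_measure R).
Local Notation F := (R -> R[i]).
Implicit Types (f g u : F) (Phi Psi : F -> R[i]).

Definition crep f : F := fun x =>
  Complex (bl_rep s (fun x => cRe (f x)) x) (bl_rep s (fun x => cIm (f x)) x).

Lemma bandlimited_ae (h1 h2 : R -> R) : bandlimited s h1 ->
  measurable_fun setT h2 -> {ae leb, forall x, h1 x = h2 x} -> bandlimited s h2.
Proof.
move=> [i1 b1] m2 e; have i2 := L1_ae i1 m2 e.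
split => // t c st; rewrite -(b1 t c st); apply: Rintegral_ae.
- exact: L1_cos.
- exact: L1_cos.
- by apply: aeS e => x ->.
Qed.

Lemma crep_ae f : inB s f -> L1eq f (crep f).
Proof.
move=> /(inBP _ s0)[br bi].
apply: aeS (aeI (bl_rep_ae s0 br) (bl_rep_ae s0 bi)) => x [er ei].
by apply: complex_ext; [exact: er|exact: ei].
Qed.

Lemma inB_crep f : inB s f -> inB s (crep f).
Proof.
move=> /(inBP _ s0)[br bi]; apply/(inBP _ s0); split.
- exact: (bandlimited_ae br (continuous_measurable_fun (continuous_bl_rep s0 br)) (bl_rep_ae s0 br)).
- exact: (bandlimited_ae bi (continuous_measurable_fun (continuous_bl_rep s0 bi)) (bl_rep_ae s0 bi)).
Qed.

(** One of the real and imaginary representatives is not identically 0, and its null zero set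
    contains almost every zero of [f]. *)
Lemma inB_neq0_ae f : inB s f -> L1norm f != 0 -> {ae leb, forall x, f x != 0}.
Proof.
move=> fB f0; have /(inBP _ s0)[br bi] := fB.
have e := crep_ae fB.
have [nr|/forallNP zr] := pselect (exists x, bl_rep s (fun x => cRe (f x)) x <> 0).
  apply: aeS (aeI e (bl_rep_zeros s0 br nr)) => x [-> nz].
  by apply/eqP => /(congr1 (@cRe R)).
have [ni|/forallNP zi] := pselect (exists x, bl_rep s (fun x => cIm (f x)) x <> 0).
  apply: aeS (aeI e (bl_rep_zeros s0 bi ni)) => x [-> nz].
  by apply/eqP => /(congr1 (@cIm R)).
exfalso; move/eqP: f0; apply.
have E : crep f = fun _ => 0.
  by apply/funext => x; apply: complex_ext; apply: contrapT; [exact: zr|exact: zi].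
rewrite E in e; rewrite (L1norm_ae (inB_cintegrable fB) (cintegrable0 R) e).
by rewrite /L1norm cnorm0 Rintegral_cst// mul0r.
Qed.

Lemma Rintegral_cRe_le f : cintegrable f ->
  \int[leb]_x `|cRe (f x)| <= L1norm f.
Proof.
move=> fi; apply: le_Rintegral => //; [exact/L1_norm/L1_cRe|exact: L1_cnorm|].
by move=> x _; exact: cRe_le.
Qed.

Lemma Rintegral_cIm_le f : cintegrable f ->
  \int[leb]_x `|cIm (f x)| <= L1norm f.
Proof.
move=> fi; apply: le_Rintegral => //; [exact/L1_norm/L1_cIm|exact: L1_cnorm|].
by move=> x _; exact: cIm_le.
Qed.

Lemma vanishing_bounded (v : R -> R) : continuous v ->
  (forall e, 0 < e -> exists X : R, forall x, X < `|x| -> `|v x| <= e) ->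
  exists M : R, forall x, `|v x| <= M.
Proof.
move=> cv v0; have [X vX] := v0 1 ltr01.
(* [X] may be negative, so the compact interval is built from [|X|]. *)
have [||c _ cmax] := @EVT_max R (fun x => `|v x|) (- `|X|) `|X|.
- by apply: le_trans (normr_ge0 X); rewrite oppr_le0.
- apply: continuous_subspaceT => x; apply: cvg_norm; exact: cv.
exists (1 + `|v c|) => x; have [xX|xX] := leP `|x| `|X|.
  by apply: le_trans (cmax x _) _; rewrite ?in_itv /= -?ler_norml// lerDr.
apply: le_trans (vX x _) _; last by rewrite lerDl.
exact: le_lt_trans (ler_norm X) xX.
Qed.

Lemma pairing_cvg0 (d : nat -> F) u (A B : R) : C0 u ->
  (forall n, cintegrable (d n)) ->
  (forall n x, `|cRe (d n x)| <= A) -> (forall n x, `|cIm (d n x)| <= A) ->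
  (forall n, L1norm (d n) <= B) ->
  (forall x, cRe (d n x) @[n --> \oo] --> (0 : R)) ->
  (forall x, cIm (d n x) @[n --> \oo] --> (0 : R)) ->
  cnorm (pairing (d n) u) @[n --> \oo] --> (0 : R).
Proof.
move=> [ur [ui u0]] di drA diA dB dr0 di0.
have vr e : 0 < e -> exists X : R, forall x, X < `|x| -> `|cRe (u x)| <= e.
  move=> /u0[X uX]; exists X => x /uX /ltW; exact: le_trans (cRe_le _).
have vi e : 0 < e -> exists X : R, forall x, X < `|x| -> `|cIm (u x)| <= e.
  move=> /u0[X uX]; exists X => x /uX /ltW; exact: le_trans (cIm_le _).
have mr := continuous_measurable_fun ur; have mi := continuous_measurable_fun ui.
have [Mr br] := vanishing_bounded ur vr; have [Mi bi] := vanishing_bounded ui vi.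
have rB n := le_trans (Rintegral_cRe_le (di n)) (dB n).
have iB n := le_trans (Rintegral_cIm_le (di n)) (dB n).
have ir n := L1_cRe (di n); have ii n := L1_cIm (di n).
have c1 := weak_cvg0 ir drA rB dr0 mr br vr.
have c2 := weak_cvg0 ii diA iB di0 mi bi vi.
have c3 := weak_cvg0 ir drA rB dr0 mi bi vi.
have c4 := weak_cvg0 ii diA iB di0 mr br vr.
rewrite -(cnorm0 R); apply: cvg_cnorm.
- have -> : (fun n => cRe (pairing (d n) u)) = (fun n =>
      \int[leb]_x (cRe (d n x) * cRe (u x)) - \int[leb]_x (cIm (d n x) * cIm (u x))).
    apply/funext => n; rewrite /pairing /cint {1}/cRe /=.
    rewrite -RintegralB//; [|exact: (L1_mulb (ir n) mr br)|exact: (L1_mulb (ii n) mi bi)].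
    by apply: eq_Rintegral => x _; rewrite cReM.
  by rewrite -[cRe _](subrr (0 : R)); exact: cvgB.
- have -> : (fun n => cIm (pairing (d n) u)) = (fun n =>
      \int[leb]_x (cRe (d n x) * cIm (u x)) + \int[leb]_x (cIm (d n x) * cRe (u x))).
    apply/funext => n; rewrite /pairing /cint {1}/cIm /=.
    rewrite -RintegralD//; [|exact: (L1_mulb (ir n) mi bi)|exact: (L1_mulb (ii n) mr br)].
    by apply: eq_Rintegral => x _; rewrite cImM.
  by rewrite -[cIm _](addr0 (0 : R)); exact: cvgD.
Qed.

(* Dominated convergence applies to |G_n| + |g| - |G_n - g|, which lies between 0
   and 2 |g|. *)
Lemma scheffe (G : nat -> F) g : (forall n, cintegrable (G n)) -> cintegrable g ->
  (forall n, L1norm (G n) <= L1norm g) ->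
  (forall x, cRe (G n x) @[n --> \oo] --> cRe (g x)) ->
  (forall x, cIm (G n x) @[n --> \oo] --> cIm (g x)) ->
  L1norm (fun x => G n x - g x) @[n --> \oo] --> (0 : R).
Proof.
move=> iG ig Gg cr ci.
have iGn n := L1_cnorm (iG n); have ign := L1_cnorm ig.
have iD n := L1_cnorm (cintegrableB (iG n) ig).
pose k n x := cnorm (G n x) + cnorm (g x) - cnorm (G n x - g x).
have ik n : L1 (k n) by apply: L1B => //; exact: L1D.
have kc : (\int[leb]_x k n x) @[n --> \oo] --> \int[leb]_x (cnorm (g x) *+ 2).
  apply: (@dominated_cvg_Rintegral _ _ _ (fun x => cnorm (g x) *+ 2)) => //.
  - by move=> n; exact: L1_measurable.
  - by under eq_fun do rewrite mulr2n; apply: L1_measurable; exact: L1D.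
  - apply: aeW => x; rewrite -[cnorm (g x) *+ 2]subr0 mulr2n; apply: cvgB.
      by apply: cvgD; [exact: cvg_cnorm|exact: cvg_cst].
    rewrite -(cnorm0 R); apply: cvg_cnorm.
      rewrite -[cRe _](subrr (cRe (g x))).
      have -> : (fun n => cRe (G n x - g x)) = (fun n => cRe (G n x) - cRe (g x)).
        by apply/funext => n; rewrite cReD cReN.
      by apply: cvgB => //; exact: cvg_cst.
    rewrite -[cIm _](subrr (cIm (g x))).
    have -> : (fun n => cIm (G n x - g x)) = (fun n => cIm (G n x) - cIm (g x)).
      by apply/funext => n; rewrite cImD cImN.
    by apply: cvgB => //; exact: cvg_cst.
  - by under eq_fun do rewrite mulr2n; exact: L1D.
  - move=> n x; rewrite /k ger0_norm ?subr_ge0 ?cnormB//.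
    have := cnormD (G n x - g x) (g x); rewrite subrK; lra.
have gg : \int[leb]_x (cnorm (g x) *+ 2) = L1norm g *+ 2.
  by under eq_Rintegral do rewrite mulr2n; rewrite (RintegralD measurableT ign ign).
rewrite gg in kc.
have kE n : \int[leb]_x k n x = L1norm (G n) + L1norm g - L1norm (fun x => G n x - g x).
  rewrite /k (RintegralB measurableT (L1D (iGn n) ign) (iD n)).
  by rewrite (RintegralD measurableT (iGn n) ign).
apply/cvgrPdist_le => e e0; near=> n; rewrite sub0r normrN ger0_norm ?L1norm_ge0//.
have : `|L1norm g *+ 2 - \int[leb]_x k n x| <= e.
  by near: n; move/cvgrPdist_le : kc; exact.
(* Since [L1norm (G n) <= L1norm g], the norm of [G n - g] is at most [2 L1norm g] minus the
   integral of [k n]. *)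
by rewrite kE ler_norml => /andP[_]; have := Gg n; lra.
Unshelve. all: end_near. Qed.

(** Functionals are maps on functions; contractivity is what makes them descend to almost everywhere
    classes, so that [f] may be replaced by [crep f]. *)
Lemma contractive_ae Phi f g : linear_on_B s Phi -> contractive s Phi ->
  inB s f -> inB s g -> L1eq f g -> Phi f = Phi g.
Proof.
move=> lin con fB gB e; apply/eqP; rewrite -subr_eq0; apply/eqP/cnorm_eq0/eqP.
rewrite eq_le cnorm_ge0 andbT -(linear_on_BB lin fB gB).
apply: le_trans (con _ (inBB fB gB)) _.
by rewrite (L1norm_eq0_sub (inB_cintegrable fB) (inB_cintegrable gB) e).
Qed.

Lemma crep_le f x : inD s f ->
  `|cRe (crep f x)| <= pi^-1 * (1 *+ 2 * s) /\
  `|cIm (crep f x)| <= pi^-1 * (1 *+ 2 * s).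
Proof.
move=> [fB f1]; have fi := inB_cintegrable fB; have /(inBP _ s0)[br bi] := fB.
split; [apply: le_trans (bl_rep_le s0 br x) _|apply: le_trans (bl_rep_le s0 bi x) _];
  rewrite ler_wpM2l ?invr_ge0 ?pi_ge0// ler_wpM2r// ler_wMn2r//; apply: le_trans f1.
- exact: Rintegral_cRe_le.
- exact: Rintegral_cIm_le.
Qed.

Lemma crep_lipschitz f x y : inD s f ->
  `|cRe (crep f x) - cRe (crep f y)| <= pi^-1 * ((s * 1) *+ 2 * s) * `|x - y| /\
  `|cIm (crep f x) - cIm (crep f y)| <= pi^-1 * ((s * 1) *+ 2 * s) * `|x - y|.
Proof.
move=> [fB f1]; have fi := inB_cintegrable fB; have /(inBP _ s0)[br bi] := fB.
split; [apply: le_trans (bl_rep_lipschitz s0 br x y) _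
  |apply: le_trans (bl_rep_lipschitz s0 bi x y) _];
  rewrite ler_wpM2r// ler_wpM2l ?invr_ge0 ?pi_ge0// ler_wpM2r// ler_wMn2r//;
  rewrite ler_wpM2l//; apply: le_trans f1.
- exact: Rintegral_cRe_le.
- exact: Rintegral_cIm_le.
Qed.

Lemma inD_crep f : inD s f -> inD s (crep f).
Proof.
move=> [fB f1]; split; first exact: inB_crep.
have cB := inB_crep fB.
by rewrite -(L1norm_ae (inB_cintegrable fB) (inB_cintegrable cB) (crep_ae fB)).
Qed.

(** Index maps are only asked to satisfy [k <= phi k], monotone or not: this carries limits over and
    is stable under composition. *)
Lemma cvg_subseq (u : nat -> R) (l : R) (phi : nat -> nat) :
  (forall k, (k <= phi k)%N) -> u @ \oo --> l -> u (phi k) @[k --> \oo] --> l.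
Proof.
move=> kphi ul; apply: cvg_comp ul.
apply/cvgnyPge => A; exists A => // k /= Ak.
exact: leq_trans (kphi k).
Qed.

Lemma cvg_norm_le (u : nat -> R) (l K : R) : (forall n, `|u n| <= K) ->
  u @ \oo --> l -> `|l| <= K.
Proof.
move=> uK ul; have nul : `|u n| @[n --> \oo] --> `|l| by apply: cvg_norm.
rewrite -(cvg_lim _ nul)//.
by apply: limr_le; [apply/cvg_ex; eexists; exact: nul|exact: nearW].
Qed.

(** Fatou keeps the norm at most 1 and [bandlimited_cvg] keeps the transforms supported in the
    band. *)
Lemma inD_cvg (G : nat -> F) g (K : R) : (forall n, inD s (G n)) ->
  (forall n x, `|cRe (G n x)| <= K) -> (forall n x, `|cIm (G n x)| <= K) ->
  (forall x, cRe (G n x) @[n --> \oo] --> cRe (g x)) ->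
  (forall x, cIm (G n x) @[n --> \oo] --> cIm (g x)) -> inD s g.
Proof.
move=> GD Kr Ki cr ci.
have iG n := inB_cintegrable (GD n).1.
have [ig g1] := @fatou_L1 _ (fun n x => cnorm (G n x)) (fun x => cnorm (g x)) 1
  (fun n x => cnorm_ge0 _) (fun n => L1_cnorm (iG n)) (fun n => (GD n).2)
  (fun x => cvg_cnorm (cr x) (ci x)).
have gr : L1 (fun x => cRe (g x)).
  apply: (@L1_le _ _ (fun x => cnorm (g x))) => //; last by move=> x; exact: cRe_le.
  apply: (measurable_fun_cvg (h := fun n x => cRe (G n x))) => [n|x _]; last exact: cr.
  by apply: L1_measurable; exact: L1_cRe.
have gi : L1 (fun x => cIm (g x)).
  apply: (@L1_le _ _ (fun x => cnorm (g x))) => //; last by move=> x; exact: cIm_le.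
  apply: (measurable_fun_cvg (h := fun n x => cIm (G n x))) => [n|x _]; last exact: ci.
  by apply: L1_measurable; exact: L1_cIm.
split=> //; apply/(inBP _ s0); split.
- apply: (@bandlimited_cvg _ s K 1 (fun n x => cRe (G n x))) => //.
  + by move=> n; have /(inBP _ s0)[] := (GD n).1.
  + by move=> n; exact: le_trans (Rintegral_cRe_le (iG n)) (GD n).2.
- apply: (@bandlimited_cvg _ s K 1 (fun n x => cIm (G n x))) => //.
  + by move=> n; have /(inBP _ s0)[] := (GD n).1.
  + by move=> n; exact: le_trans (Rintegral_cIm_le (iG n)) (GD n).2.
Qed.

(** Two successive extractions: real parts, then imaginary parts along the first index map. *)
Lemma inD_subsequence (fn : nat -> F) : (forall n, inD s (fn n)) ->
  exists (g : F) (phi : nat -> nat), [/\ inD s g, forall k, (k <= phi k)%N,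
    forall x, cRe (crep (fn (phi k)) x) @[k --> \oo] --> cRe (g x) &
    forall x, cIm (crep (fn (phi k)) x) @[k --> \oo] --> cIm (g x)].
Proof.
move=> fD.
have [g1 [phi1 [k1 c1]]] := lipschitz_subsequence
  (fun n x => (crep_le x (fD n)).1) (fun n x y => (crep_lipschitz x y (fD n)).1).
have [g2 [phi2 [k2 c2]]] := lipschitz_subsequence
  (fun n x => (crep_le x (fD (phi1 n))).2) (fun n x y => (crep_lipschitz x y (fD (phi1 n))).2).
have cr x : cRe (crep (fn (phi1 (phi2 k))) x) @[k --> \oo] --> g1 x.
  exact: (@cvg_subseq (fun k => cRe (crep (fn (phi1 k)) x))).
exists (fun x => Complex (g1 x) (g2 x)), (phi1 \o phi2); split => //.
- apply: (@inD_cvg (fun k => crep (fn (phi1 (phi2 k)))) _ (pi^-1 * (1 *+ 2 * s))) => //.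
  + by move=> n; exact: inD_crep.
  + by move=> n x; exact: (crep_le x (fD _)).1.
  + by move=> n x; exact: (crep_le x (fD _)).2.
- by move=> k /=; exact: leq_trans (k2 k) (k1 _).
Qed.

(** A basic weak* neighbourhood involves finitely many test functions, so it is enough that each
    pairing tends to 0, which is [pairing_cvg0]. *)
Lemma weakstar_cvg Phi (G : nat -> F) g (K : R) : weakstar_continuous s Phi ->
  (forall n, inD s (G n)) -> inD s g ->
  (forall n x, `|cRe (G n x)| <= K) -> (forall n x, `|cIm (G n x)| <= K) ->
  (forall x, cRe (G n x) @[n --> \oo] --> cRe (g x)) ->
  (forall x, cIm (G n x) @[n --> \oo] --> cIm (g x)) ->
  cnorm (Phi (G n) - Phi g) @[n --> \oo] --> (0 : R).
Proof.
move=> wPhi GD gD Kr Ki cr ci; apply/cvgrPdist_lt => e e0.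
have [m [us [d [d0 [usC0 H]]]]] := wPhi g gD.1 e e0.
have iG n := inB_cintegrable (GD n).1; have ig := inB_cintegrable gD.1.
have gK x : `|cRe (g x)| <= K by exact: cvg_norm_le (cr x).
have gK' x : `|cIm (g x)| <= K by exact: cvg_norm_le (ci x).
have near_us : \forall n \near \oo, forall i, cnorm (pairing (fun x => G n x - g x) (us i)) < d.
  apply: filter_forall => i.
  have := @pairing_cvg0 (fun n x => G n x - g x) (us i) (K + K) (1 + 1) (usC0 i).
  move=> /(_ _ _ _ _ _ _)/cvgrPdist_lt => P.
  have {}P := P (fun n => cintegrableB (iG n) ig).
  have {P} : \forall n \near \oo, `|0 - cnorm (pairing (fun x => G n x - g x) (us i))| < d.
    apply: P => //.
    - move=> n x; rewrite cReD cReN; apply: le_trans (ler_normB _ _) _; exact: lerD.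
    - move=> n x; rewrite cImD cImN; apply: le_trans (ler_normB _ _) _; exact: lerD.
    - move=> n; apply: (@le_trans _ _ (L1norm (G n) + L1norm g)).
        rewrite /L1norm -RintegralD//; [|exact: L1_cnorm|exact: L1_cnorm].
        apply: le_Rintegral => //; [exact/L1_cnorm/cintegrableB|by apply: L1D; exact: L1_cnorm|].
        by move=> x _; exact: cnormB.
      by apply: lerD; [exact: (GD n).2|exact: gD.2].
    - move=> x; have -> : (fun n => cRe (G n x - g x)) = (fun n => cRe (G n x) - cRe (g x)).
        by apply/funext => n; rewrite cReD cReN.
      by rewrite -(subrr (cRe (g x))); apply: cvgB => //; exact: cvg_cst.
    - move=> x; have -> : (fun n => cIm (G n x - g x)) = (fun n => cIm (G n x) - cIm (g x)).
        by apply/funext => n; rewrite cImD cImN.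
      by rewrite -(subrr (cIm (g x))); apply: cvgB => //; exact: cvg_cst.
  by apply: filterS => n; rewrite sub0r normrN ger0_norm ?cnorm_ge0.
apply: filterS near_us => n Hn.
by rewrite sub0r normrN ger0_norm ?cnorm_ge0//; exact: H (GD n).1 Hn.
Qed.

Lemma wstar_exposing_strong f Phi (fn : nat -> F) : inD s f -> exposing s f Phi ->
  weakstar_continuous s Phi -> (forall n, inD s (fn n)) ->
  cnorm (Phi (fn n) - 1) @[n --> \oo] --> (0 : R) ->
  L1norm (fun x => fn n x - f x) @[n --> \oo] --> (0 : R).
Proof.
move=> fD ex wPhi fnD Phi1; have con := exposing_contractive ex.
have [[lin _] [Phif [_ exp]]] := ex.
apply: contrapT => nc.
have [e [e0 He]] : exists e : R, 0 < e /\
    forall N : nat, exists n, (N <= n)%N /\ e < L1norm (fun x => fn n x - f x).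
  apply: contrapT => nex; apply: nc; apply/cvgrPdist_le => e e0.
  apply: contrapT => ne; apply: nex; exists e; split => // N.
  apply: contrapT => nN; apply: ne; exists N => // n /= Nn.
  rewrite sub0r normrN ger0_norm ?L1norm_ge0// leNgt; apply/negP => en.
  by apply: nN; exists n.
(* [psi] lists indices, arbitrarily large, at which the distance to [f] stays above [e]; every
   further extraction inherits this gap. *)
have [psi psiP] := choice He.
have [g [phi [gD kphi cr ci]]] := inD_subsequence (fun n => fnD (psi n)).
pose th k := psi (phi k).
have kth k : (k <= th k)%N by exact: leq_trans (kphi k) (psiP _).1.
pose G k := crep (fn (th k)).
have GD k : inD s (G k) by exact: inD_crep.
have PhiG k : Phi (G k) = Phi (fn (th k)).
  by apply/esym/contractive_ae => //; [exact: (fnD _).1|exact: (GD k).1|apply: crep_ae; exact: (fnD _).1].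
have cG := weakstar_cvg wPhi GD gD (fun k x => (crep_le x (fnD (th k))).1)
  (fun k x => (crep_le x (fnD (th k))).2) cr ci.
have c1 : cnorm (Phi (G k) - 1) @[k --> \oo] --> (0 : R).
  under eq_fun do rewrite PhiG.
  exact: (@cvg_subseq (fun n => cnorm (Phi (fn n) - 1)) _ _ kth Phi1).
have Phig : Phi g = 1.
  apply/eqP; rewrite -subr_eq0; apply/eqP/cnorm_eq0/eqP; rewrite eq_le cnorm_ge0 andbT.
  have cs : (cnorm (Phi (G k) - 1) + cnorm (Phi (G k) - Phi g)) @[k --> \oo] --> (0 : R).
    by rewrite -(addr0 (0 : R)); exact: cvgD.
  have /(_ (@Rhausdorff R)) <- := cvg_lim _ cs.
  apply: limr_ge; first by apply/cvg_ex; eexists; exact: cs.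
  apply: nearW => k /=; rewrite -[X in cnorm X <= _](_ : (Phi (G k) - 1) - (Phi (G k) - Phi g) = _).
    exact: cnormB.
  by rewrite opprB addrC addrA subrK.
have gf : L1eq g f.
  apply: contrapT => ngf; have := exp g gD ngf.
  by rewrite Phig /cRe /= ltxx.
(* No mass is lost in the limit: this norm equality supplies the hypothesis of [scheffe]. *)
have L1g : L1norm g = 1.
  apply/eqP; rewrite eq_le gD.2 /=.
  by apply: le_trans (con g gD.1); rewrite Phig cnorm1.
have iG k := inB_cintegrable (GD k).1; have ig := inB_cintegrable gD.1.
have ifn n := inB_cintegrable (fnD n).1; have if_ := inB_cintegrable fD.1.
have GL k : L1norm (G k) <= L1norm g by rewrite L1g; exact: (GD k).2.
have := scheffe iG ig GL cr ci => /cvgrPdist_lt/(_ _ e0)[N _ /(_ N (leqnn N))].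
rewrite sub0r normrN ger0_norm ?L1norm_ge0//.
rewrite (@L1norm_ae _ _ (fun x => fn (th N) x - f x)).
- by move=> /ltW; rewrite leNgt => /negP; apply; exact: (psiP _).2.
- exact: cintegrableB.
- exact: cintegrableB.
- by apply: aeS (aeI (crep_ae (fnD (th N)).1) gf) => x [-> ->].
Qed.

End StrongExposedness.

Theorem theorem4p4 (R : realType) (sigma : R) (hsigma : 0 < sigma)
  (f : R -> R[i]) :
  wstar_exposed sigma f <-> wstar_strongly_exposed sigma f.
Proof.
split=> [wf|[]//]; split => //; have [fD [Phi [ex wPhi]]] := wf.
split; first by split => //; exists Phi.
move=> Psi exPsi fn fnD Psi1; have s0 := ltW hsigma.
have conPhi := exposing_contractive ex; have conPsi := exposing_contractive exPsi.
have [[linPhi _] [Phif _]] := ex; have [[linPsi _] [Psif _]] := exPsi.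
have f0 : {ae lebesgue_measure, forall x, f x != 0}.
  apply: (inB_neq0_ae s0 fD.1); rewrite gt_eqF//; apply: lt_le_trans ltr01 _.
  by rewrite -(cnorm1 R) -Phif conPhi//; exact: fD.1.
apply: (wstar_exposing_strong s0 fD ex wPhi fnD).
(* The given [Psi] need not be presented as weak* continuous; agreement with [Phi] on the space
   transfers the hypothesis to [Phi]. *)
have -> : (fun n => cnorm (Phi (fn n) - 1)) = (fun n => cnorm (Psi (fn n) - 1)).
  apply/funext => n; congr (cnorm (_ - 1)).
  by apply: (functional_unique linPhi linPsi conPhi conPsi fD) => //; exact: (fnD n).1.
exact: Psi1.
Qed.
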